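(* For all $\gamma>0$ there exists $n_0=n_0(\gamma)\in\mathbb{N}$ such that for every $n\ge n_0$ with $n\in 3\mathbb{N}$ and every integer $q$ with $1\le q\le \left(1-\sqrt{2/3}\right)n$ the following holds. Suppose $H$ is a $3$-graph on $n$ vertices with degree sequence $d_1\le\ldots\le d_n$ such that $$d_i\ge\begin{cases}\left(\frac13+\gamma\right)\binom n2+iq & \text{if } 1\le i\le q,\\ \left(\frac49+\gamma\right)\binom n2 & \text{if } q<i\le \frac n3,\\ \left(\frac59+\gamma\right)\binom n2 & \text{if } \frac n3<i.\end{cases}$$ Then $H$ contains a perfect matching.
   Context: A $3$-graph $H$ is a finite vertex set $V(H)$ together with a set $E(H)$ of $3$-element subsets of $V(H)$ (edges). The degree of a vertex $v$ is the number of edges containing $v$. The degree sequence $d_1\le\ldots\le d_n$ of an $n$-vertex $3$-graph is the list of its vertex degrees in nondecreasing order. A perfect matching is a collection of pairwise disjoint edges covering all vertices. *)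

(* Defs.v *)
From mathcomp Require Import all_boot.

Set Implicit Arguments.
Unset Strict Implicit.
Unset Printing Implicit Defensive.

Record graph3 (V : finType) := Graph3 {
  edges : {set {set V}};
  card_edge : forall e : {set V}, e \in edges -> #|e| = 3
}.

Definition degree (V : finType) (H : graph3 V) (v : V) : nat :=
  #|[set e in edges H | v \in e]|.

Definition degree_sequence (V : finType) (H : graph3 V) : seq nat :=
  sort leq [seq degree H v | v <- enum V].

(* d_i with 1-based indexing, meaningful for 1 <= i <= #|V| only. *)
Definition deg_nth (V : finType) (H : graph3 V) (i : nat) : nat :=
  nth 0 (degree_sequence H) i.-1.

Definition perfect_matching (V : finType) (H : graph3 V) (M : {set {set V}}) :
    Prop :=
  [/\ M \subset edges H,
      {in M &, forall e f : {set V}, e != f -> [disjoint e & f]}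
    & cover M = [set: V]].

(* Main.v *)
(* Let Q and S be the sets of vertices of degree below
   (4/9 + g) C(n,2) and (5/9 + g) C(n,2); then |Q| <= q and |S| <= n/3, and all
   degrees are at least (1/3 + g) C(n,2).

   Absorption.  As (1 - |Q|/n)^2 >= 2/3, every vertex lies in order n^2 edges with
   two vertices outside Q, and a vertex outside Q has order n^2 common link edges
   with one outside S.  Hence every triple is absorbed by a positive fraction of
   the 24-tuples, and a linear number of disjoint 24-tuples containing linearly
   many absorbers of each triple is chosen greedily.

   Fractional matchings.  If H[U] has no perfect fractional matching, take an
   optimal fractional cover w together with an optimal fractional matching x.
   Edges in the support of x have weight 1 and unsaturated vertices weight 0.  The
   number of pairs of weight at least 1 - t is an average over two independent
   edges chosen according to x of the number of such pairs between them, out of 9.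
   For t = 0, the least weight outside Q and the least weight outside S these
   averages exceed 3, 4 and 5, which is impossible for weights adding up to 1.

   Almost perfect matching.  A perfect fractional matching of H[U] removes all
   vertices of U at the same rate, so removing suitable edges one at a time keeps
   all link densities and the proportions of Q and S almost unchanged; an
   exponential potential chooses the edges.  The process stops with few vertices
   left, and these are absorbed. *)
Require Import Defs.
From mathcomp Require Import all_boot all_order all_algebra.
From mathcomp Require Import reals.
From mathcomp Require Import boolp sequences exp.
From mathcomp Require Import ring lra zify.

Set Implicit Arguments.
Unset Strict Implicit.
Unset Printing Implicit Defensive.

Import Order.TTheory GRing.Theory Num.Theory.
Local Open Scope ring_scope.

(** * Linear programming duality *)

(* Induction on the number of forms.  If the last form cannot be dropped, it is
   positive at a point z where the other forms are nonpositive; projecting along z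
   onto its kernel reduces to one form less. *)
Lemma farkas (R : realFieldType) (X : lmodType R) (m : nat)
    (a : nat -> X -> R) (b : X -> R) :
  (forall i (k : R) x y, a i (k *: x + y) = k * a i x + a i y) ->
  (forall (k : R) x y, b (k *: x + y) = k * b x + b y) ->
  (forall x, (forall i, (i < m)%N -> a i x <= 0) -> b x <= 0) ->
  exists2 l : nat -> R, (forall i, 0 <= l i) &
    forall x, b x = \sum_(i < m) l i * a i x.
Proof.
elim: m a b => [|m IHm] a b linA linB hb.
  exists (fun=> 0) => // x; rewrite big_ord0; apply/le_anti/andP; split.
    exact: hb.
  have b0 : b 0 = 0.
    by have := linB (-1) 0 0; rewrite scaler0 addr0 mulN1r addNr.
  have := hb (- x) (fun i => ltac:(by [])).
  have := linB (-1) x 0; rewrite scaleN1r addr0 => ->.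
  by rewrite b0 addr0 mulN1r oppr_le0.
have [hm|/existsNP[z /not_implyP[za /negP]]] :=
    pselect (forall x, (forall i, (i < m)%N -> a i x <= 0) -> b x <= 0).
  have [l l0 lE] := IHm a b linA linB hm.
  exists (fun i => if (i < m)%N then l i else 0) => [i|x]; first by case: ifP.
  rewrite big_ord_recr /= ltnn mul0r addr0 lE.
  by apply: eq_bigr => i _; rewrite ltn_ord.
rewrite -ltNge => bz.
have az : 0 < a m z.
  rewrite ltNge; apply/negP => am; move: bz; rewrite ltNge => /negP; apply.
  by apply: hb => i; rewrite ltnS leq_eqVlt => /predU1P[->//|/za].
pose y := (a m z)^-1 *: z.
have lin0 f : (forall (k : R) x y, f (k *: x + y) = k * f x + f y) ->
    forall k x, f (k *: x) = k * f x :> R.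
  move=> linf k x; rewrite -[k *: x]addr0 linf.
  have -> : f 0 = 0; last by rewrite addr0.
  by have := linf (-1) 0 0; rewrite scaler0 addr0 mulN1r addNr.
have amy : a m y = 1 by rewrite lin0 // mulVf ?gt_eqF.
have by0 : 0 < b y by rewrite lin0 // mulr_gt0 ?invr_gt0.
have ay i : (i < m)%N -> a i y <= 0.
  by move=> im; rewrite lin0 // pmulr_rle0 ?invr_gt0 //; exact: za.
have [||x hx|l l0 lE] := IHm (fun i x => a i x - a i y * a m x)
                            (fun x => b x - b y * a m x).
- by move=> i k x x'; rewrite !linA; ring.
- by move=> k x x'; rewrite linB linA; ring.
- have zE f : (forall (k : R) x y, f (k *: x + y) = k * f x + f y) ->
      f ((- a m x) *: y + x) = f x - f y * a m x :> R.
    by move=> linf; rewrite linf; ring.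
  rewrite -zE //; apply: hb => i; rewrite ltnS leq_eqVlt => /predU1P[->|im].
    by rewrite zE // amy mul1r subrr.
  by rewrite zE //; exact: hx.
exists (fun i => if (i < m)%N then l i
                 else b y - \sum_(j < m) l j * a j y) => [i|x].
  case: ifP => // _; rewrite subr_ge0 (le_trans _ (ltW by0)) //.
  by apply: sumr_le0 => j _; rewrite mulr_ge0_le0 ?ay.
rewrite big_ord_recr /= ltnn.
have := lE x; move/eqP; rewrite subr_eq => /eqP ->.
rewrite mulrBl addrCA addrC; congr (_ + _).
rewrite mulr_suml -sumrB; apply: eq_bigr => i _; rewrite ltn_ord; ring.
Qed.

Lemma farkas_fin (R : realFieldType) (X : lmodType R) (I : finType)
    (a : I -> X -> R) (b : X -> R) :
  (forall i (k : R) x y, a i (k *: x + y) = k * a i x + a i y) ->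
  (forall (k : R) x y, b (k *: x + y) = k * b x + b y) ->
  (forall x, (forall i, a i x <= 0) -> b x <= 0) ->
  exists2 l : I -> R, (forall i, 0 <= l i) &
    forall x, b x = \sum_i l i * a i x.
Proof.
move=> linA linB hb.
pose a' k x := if insub k is Some o then a (@enum_val I I o) x else 0.
have a'E (o : 'I_#|I|) x : a' o x = a (enum_val o) x.
  by rewrite /a' valK.
have [||x hx|l l0 lE] := @farkas R X #|I| a' b.
- move=> i k x y; rewrite /a'; case: insub => [o|]; first exact: linA.
  by rewrite mulr0 addr0.
- exact: linB.
- apply: hb => i.
  by have := hx (enum_rank i) (ltn_ord _); rewrite a'E enum_rankK.
exists (fun i => l (enum_rank i)) => // x.
rewrite lE (reindex_onto (fun i : I => enum_rank i) (@enum_val I I)) /=; last first.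
  by move=> o _; rewrite enum_valK.
rewrite (eq_bigl xpredT) => [|i]; last by rewrite enum_rankK eqxx.
by apply: eq_bigr => i _; rewrite a'E enum_rankK.
Qed.

(** All constraints, including the duality inequality, are homogenised by a scalar [t]. A solution
    with [t > 0] rescales to the required pair. Otherwise Farkas writes the form [t] as a
    nonnegative combination of the constraints, and evaluating this identity at three points gives a
    contradiction. *)
Lemma matching_cover_duality (R : realFieldType) (V : finType) (U : {set V})
    (E : {set {set V}}) :
  (forall e, e \in E -> e != set0 /\ e \subset U) ->
  exists (w : V -> R) (x : {set V} -> R),
    [/\ forall v, 0 <= w v, forall e, 0 <= x e,
        forall e, e \in E -> 1 <= \sum_(v in e) w v,
        forall v, v \in U -> \sum_(e in E | v \in e) x e <= 1
      & \sum_(v in U) w v <= \sum_(e in E) x e].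
Proof.
move=> hE.
pose X : lmodType R := ({ffun V -> R^o} * {ffun {set V} -> R^o} * R^o)%type.
pose sw (w : {ffun V -> R^o}) (e : {set V}) : R := \sum_(v in e) w v.
pose sx (x : {ffun {set V} -> R^o}) (v : V) : R := \sum_(e in E | v \in e) x e.
pose I := (V + {set V} + {set V} + V + unit)%type.
pose a (i : I) (X : X) : R := let: (w, x, t) := X in
  match i with
  | inl (inl (inl (inl v))) => - w v
  | inl (inl (inl (inr e))) => - x e
  | inl (inl (inr e)) => if e \in E then t - sw w e else 0
  | inl (inr v) => if v \in U then sx x v - t else 0
  | inr _ => \sum_(v in U) w v - \sum_(e in E) x e
  end.
have linsum (J : finType) (P : pred J) (k : R) (f g : {ffun J -> R^o}) :
    \sum_(j | P j) (k *: f + g) j = k * (\sum_(j | P j) f j) + \sum_(j | P j) g j.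
  rewrite mulr_sumr -big_split /=; apply: eq_bigr => j _.
  by rewrite !ffunE.
have linA i (k : R) y z : a i (k *: y + z) = k * a i y + a i z.
  case: y => [[w x] t]; case: z => [[w' x'] t'].
  case: i => [[[[v|e]|e]|v]|?] /=.
  - by rewrite !ffunE /=; rewrite /GRing.scale /=; ring.
  - by rewrite !ffunE /=; rewrite /GRing.scale /=; ring.
  - case: ifP => _; last by rewrite mulr0 addr0.
    by rewrite /sw linsum [k *: t]/GRing.scale /=; ring.
  - case: ifP => _; last by rewrite mulr0 addr0.
    by rewrite /sx linsum [k *: t]/GRing.scale /=; ring.
  - by rewrite !linsum; ring.
have [[[[w x] t] [hX /= t0]]|noX] :=
    pselect (exists y : X, (forall i, a i y <= 0) /\ 0 < y.2).
  have ti0 : 0 < t^-1 by rewrite invr_gt0.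
  exists (fun v => t^-1 * w v), (fun e => t^-1 * x e); split.
  - move=> v; have := hX (inl (inl (inl (inl v)))); rewrite /= oppr_le0 => hv.
    by rewrite mulr_ge0 // ltW.
  - move=> e; have := hX (inl (inl (inl (inr e)))); rewrite /= oppr_le0 => hv.
    by rewrite mulr_ge0 // ltW.
  - move=> e eE; have := hX (inl (inl (inr e))); rewrite /= eE subr_le0 => he.
    rewrite -mulr_sumr mulrC ler_pdivlMr // mul1r; exact: he.
  - move=> v vU; have := hX (inl (inr v)); rewrite /= vU subr_le0 => hv.
    rewrite -mulr_sumr mulrC ler_pdivrMr // mul1r; exact: hv.
  - have := hX (inr tt); rewrite /= subr_le0 => h.
    by rewrite -!mulr_sumr ler_pM2l.
have [||y hy|l l0 lE] := @farkas_fin R X I a (fun y => y.2).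
- exact: linA.
- by move=> k [y t] [y' t'].
- by rewrite leNgt; apply/negP => ?; apply: noX; exists y.
pose al v := l (inl (inl (inl (inl v)))).
pose be e := l (inl (inl (inl (inr e)))).
pose y e := if e \in E then l (inl (inl (inr e))) else 0.
pose z v := if v \in U then l (inl (inr v)) else 0.
pose tau := l (inr tt).
have y0 e : 0 <= y e by rewrite /y; case: ifP.
have z0 v : 0 <= z v by rewrite /z; case: ifP.
have lE' (w : {ffun V -> R^o}) (x : {ffun {set V} -> R^o}) (t : R) :
    t = - (\sum_v al v * w v) - (\sum_e be e * x e)
   + \sum_(e in E) y e * (t - sw w e) + \sum_(v in U) z v * (sx x v - t)
   + tau * (\sum_(v in U) w v - \sum_(e in E) x e).
  have := lE (w, x, t); rewrite /= => {1}->; rewrite !big_sumType /= (big_pred1 tt) => [|[]//].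
  congr (_ + _ + _ + _ + _).
  - by rewrite -sumrN; apply: eq_bigr => v _; rewrite mulrN.
  - by rewrite -sumrN; apply: eq_bigr => v _; rewrite mulrN.
  - rewrite [RHS]big_mkcond; apply: eq_bigr => e _; rewrite /y.
    by case: ifP; rewrite ?mulr0.
  - rewrite [RHS]big_mkcond; apply: eq_bigr => e _; rewrite /z.
    by case: ifP; rewrite ?mulr0.
have sum0 (J : finType) (P : pred J) : \sum_(j | P j) (0 : {ffun J -> R^o}) j = 0.
  by rewrite big1 // => j _; rewrite ffunE.
have sum0' (J : finType) (P : pred J) (f : J -> R) :
    \sum_(j | P j) f j * (0 : {ffun J -> R^o}) j = 0.
  by rewrite big1 // => j _; rewrite ffunE mulr0.
(* Evaluation at [w = 0], [x = 0], [t = 1]. *)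
have E1 : 1 = \sum_(e in E) y e - \sum_(v in U) z v.
  have := lE' 0 0 1; rewrite !sum0' !sum0 subrr mulr0 addr0 oppr0 addr0 add0r.
  move=> {1}->; rewrite -sumrN; congr (_ + _); apply: eq_bigr => j _.
    by rewrite /sw sum0 subr0 mulr1.
  by rewrite /sx sum0 sub0r mulrN1.
have cross : \sum_(e in E) y e * (\sum_(v in e) z v) =
             \sum_(v in U) z v * (\sum_(e in E | v \in e) y e).
  rewrite (eq_bigr (fun e : {set V} => \sum_(v in U) if v \in e then y e * z v else 0)).
    rewrite exchange_big /=; apply: eq_bigr => v _.
    by rewrite mulr_sumr -big_mkcondr /=; apply: eq_bigr => e _; exact: mulrC.
  move=> e eE; rewrite mulr_sumr big_mkcond [RHS]big_mkcond /=.
  apply: eq_bigr => v _; have [ve|_] := boolP (v \in e); last by rewrite if_same.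
  by rewrite (subsetP (hE _ eE).2).
(* Evaluation at the multipliers themselves: [w = z], [x = y], [t = 0]. The cover and matching terms
   cancel by [cross], the last term is [- tau] by [E1], and what remains is nonpositive. *)
have E2 : tau = 0.
  have := lE' [ffun v => z v] [ffun e => y e] 0.
  have -> : \sum_(e in E) y e * (0 - sw [ffun v => z v] e) =
      - \sum_(e in E) y e * (\sum_(v in e) z v).
    rewrite -sumrN; apply: eq_bigr => e _; rewrite /sw sub0r mulrN.
    by under eq_bigr do rewrite ffunE.
  have -> : \sum_(v in U) z v * (sx [ffun e => y e] v - 0) =
      \sum_(v in U) z v * (\sum_(e in E | v \in e) y e).
    apply: eq_bigr => v _; rewrite /sx subr0.
    by under eq_bigr do rewrite ffunE.
  rewrite cross.
  have -> : \sum_(v in U) [ffun v0 => z v0] v = \sum_(v in U) z v :> R.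
    by apply: eq_bigr => v _; rewrite ffunE.
  have -> : \sum_(e in E) [ffun e0 => y e0] e = \sum_(e in E) y e :> R.
    by apply: eq_bigr => v _; rewrite ffunE.
  have : 0 <= \sum_v al v * [ffun v0 => z v0] v.
    by apply: sumr_ge0 => v _; rewrite ffunE mulr_ge0 // l0.
  have : 0 <= \sum_e be e * [ffun v0 => y v0] e.
    by apply: sumr_ge0 => v _; rewrite ffunE mulr_ge0 // l0.
  have -> : \sum_(v in U) z v - \sum_(e in E) y e = -1 by rewrite [1]E1 opprB.
  have : 0 <= tau by exact: l0.
  lra.
(* Evaluation at [w = 1], [x = 0], [t = 0], where every edge has weight at least 1 because it is
   nonempty. As [z] is nonnegative, this contradicts [E1]. *)
have E3 : \sum_(e in E) y e <= 0.
  have := lE' [ffun=> 1] 0 0; rewrite sum0' E2 mul0r addr0.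
  have -> : \sum_(v in U) z v * (sx 0 v - 0) = 0.
    by rewrite big1 // => v _; rewrite /sx sum0 subr0 mulr0.
  have : 0 <= \sum_v al v * [ffun=> 1] v.
    by apply: sumr_ge0 => v _; rewrite ffunE mulr1; exact: l0.
  have : \sum_(e in E) y e * (0 - sw [ffun=> 1] e) <= - \sum_(e in E) y e.
    rewrite -sumrN; apply: ler_sum => e eE; rewrite sub0r mulrN lerN2.
    rewrite ler_peMr // /sw; under eq_bigr do rewrite ffunE.
    rewrite sumr_const ler1n card_gt0; exact: (hE _ eE).1.
  lra.
have : 0 <= \sum_(v in U) z v by apply: sumr_ge0.
lra.
Qed.

(** * The kernel inequality for fractional covers *)

Section Kernel.
Variable R : realFieldType.
Implicit Types (t a : R) (x y : R * R * R).

(* [nine t x y] counts the pairs (k, l) for which a vertex of weight t completes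
   the k-th vertex of an edge with weights x and the l-th vertex of an edge with
   weights y to a triple of weight at least 1. *)
Definition cell t (u v : R) : R := (1 - t <= u + v)%R%:R.

Definition nine t x y : R :=
  let: (x1, x2, x3) := x in let: (y1, y2, y3) := y in
    cell t x1 y1 + cell t x1 y2 + cell t x1 y3
  + cell t x2 y1 + cell t x2 y2 + cell t x2 y3
  + cell t x3 y1 + cell t x3 y2 + cell t x3 y3.

Arguments nine : simpl never.

Definition tight x :=
  let: (x1, x2, x3) := x in
  [/\ 0 <= x1, x1 <= x2, x2 <= x3 & x1 + x2 + x3 <= 1].

(** Among [tight] triples these three tests single out [(0, 0, 1)], [(0, 1/2, 1/2)] and
    [(1/3, 1/3, 1/3)]. For [t = 0] only two spikes or two [halves] can have more than 3 good cells,
    and two flat triples have none. *)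
Definition spike x : bool := let: (_, x2, x3) := x in (x2 == 0) && (x3 == 1).
Definition halves x : bool := let: (_, x2, x3) := x in (x2 == 1/2) && (x3 == 1/2).
Definition flat x : bool := let: (x1, _, _) := x in x1 == 1/3.
(* For 0 <= a < 1/3 at most 5 of the 9 pairs are good unless x_2 + y_1 >= 1 - a or
   x_1 + y_2 >= 1 - a.  As x_2 <= 1/2 and y_1 <= 1/3, the former implies
   2/3 - a <= x_2 and 1/2 - a <= y_1. *)
Definition inner a x : bool :=
  let: (x1, x2, _) := x in (0 < x1) && ((2/3 - a <= x2) || (1/2 - a <= x1)).
Definition outer a x : bool :=
  let: (x1, x2, _) := x in (x1 == 0) && (2/3 - a <= x2).

Lemma cell_ge0 t u v : 0 <= cell t u v. Proof. exact: ler0n. Qed.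
Lemma cell_le1 t u v : cell t u v <= 1.
Proof. by rewrite /cell lern1 leq_b1. Qed.
Lemma cell_eq0 t u v : u + v < 1 - t -> cell t u v = 0.
Proof. by move=> h; rewrite /cell leNgt h. Qed.
Lemma cell_excl2 t u v u' v' : u + v + u' + v' < 2 - 2 * t ->
  cell t u v + cell t u' v' <= 1.
Proof.
move=> h; rewrite /cell; case: (lerP _ (u + v)) => ?;
  case: (lerP _ (u' + v')) => ? /=; lra.
Qed.
Lemma cell_excl3 t u v u' v' u'' v'' :
  u + v + u' + v' + u'' + v'' < 3 - 3 * t ->
  cell t u v + cell t u' v' + cell t u'' v'' <= 2.
Proof.
move=> h; rewrite /cell; case: (lerP _ (u + v)) => ?;
  case: (lerP _ (u' + v')) => ?;
  case: (lerP _ (u'' + v'')) => ? /=; lra.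
Qed.
Lemma nineC t x y : nine t x y = nine t y x.
Proof.
case: x => [[x1 x2] x3]; case: y => [[y1 y2] y3]; rewrite /nine /cell.
by rewrite !(addrC y1) !(addrC y2) !(addrC y3); ring.
Qed.

Ltac bounds t :=
  repeat match goal with
  | |- context [cell t ?u ?v] =>
      have := cell_le1 t u v; have := cell_ge0 t u v;
      move: (cell t u v) => ? ? ?
  end; move=> /= *; lra.

Ltac kill t u v := rewrite (@cell_eq0 t u v); last by lra.

(** Only the row of [x3] and the column of [y3] can contain good cells, and the column adds to the
    row only if [y3 = 1]. *)
Lemma nine0_spike x y : tight x -> tight y -> spike x ->
  nine 0 x y <= 3 + 2 * (spike y)%:R.
Proof.
case: x => [[x1 x2] x3]; case: y => [[y1 y2] y3] [x1p x12 x23 sx] [y1p y12 y23 sy].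
rewrite /spike /nine => /andP[/eqP ? /eqP ?]; subst x2 x3.
kill (0 : R) x1 y1; kill (0 : R) x1 y2; kill (0 : R) (0 : R) y1; kill (0 : R) (0 : R) y2.
have [/andP[/eqP ? /eqP ?]|ny] := boolP (_ && _).
  by bounds (0 : R).
have y3l : y3 < 1.
  rewrite ltNge; apply/negP => y3g; move/negP: ny; apply.
  by apply/andP; split; apply/eqP; lra.
kill (0 : R) x1 y3; kill (0 : R) (0 : R) y3.
by bounds (0 : R).
Qed.

(** The row of [x1 = 0] fails since [y3 < 1], and the column of [y1] fails since [y1 <= 1/3]. Of the
    remaining four cells, the two with [y2] need [y2 = 1/2]. *)
Lemma nine0_halves x y : tight x -> tight y -> halves x -> ~~ spike y ->
  nine 0 x y <= 2 + 2 * (halves y)%:R.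
Proof.
case: x => [[x1 x2] x3]; case: y => [[y1 y2] y3] [x1p x12 x23 sx] [y1p y12 y23 sy].
rewrite /halves /spike /nine => /andP[/eqP ? /eqP ?] ny; subst x2 x3.
have y3l : y3 < 1.
  rewrite ltNge; apply/negP => y3g; move/negP: ny; apply.
  by apply/andP; split; apply/eqP; lra.
kill (0 : R) x1 y1; kill (0 : R) x1 y2; kill (0 : R) x1 y3.
kill (0 : R) (1/2 : R) y1.
have [_|nh] /= := boolP (_ && _); first by bounds (0 : R).
have y2l : y2 < 1/2.
  rewrite ltNge; apply/negP => y2g; move/negP: nh; apply.
  by apply/andP; split; apply/eqP; lra.
kill (0 : R) (1/2 : R) y2.
by bounds (0 : R).
Qed.

(** The four cells between the two smaller entries fail. Of the other five, [(x1, y3)] excludes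
    [(x3, y2)] and [(x3, y1)] excludes [(x2, y3)], since both of a pair would need total weight
    2. *)
Lemma nine0_generic x y : tight x -> tight y ->
  ~~ spike x -> ~~ spike y -> ~~ (halves x && halves y) -> nine 0 x y <= 3.
Proof.
case: x => [[x1 x2] x3]; case: y => [[y1 y2] y3] [x1p x12 x23 sx] [y1p y12 y23 sy].
rewrite /halves /spike /nine => nx ny nh.
have x3l : x3 < 1.
  rewrite ltNge; apply/negP => g; move/negP: nx; apply.
  by apply/andP; split; apply/eqP; lra.
have y3l : y3 < 1.
  rewrite ltNge; apply/negP => g; move/negP: ny; apply.
  by apply/andP; split; apply/eqP; lra.
kill (0 : R) x1 y1; kill (0 : R) x1 y2; kill (0 : R) x2 y1.
have xy22 : x2 + y2 < 1.
  rewrite ltNge; apply/negP => g; move/negP: nh; apply.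
  by apply/andP; split; apply/andP; split; apply/eqP; lra.
kill (0 : R) x2 y2.
have := @cell_excl2 0 x1 y3 x3 y2 ltac:(lra).
have := @cell_excl2 0 x3 y1 x2 y3 ltac:(lra).
by bounds (0 : R).
Qed.

(** The bounds are 5 for two spikes, 4 for two [halves], 2 for [halves] against a triple of neither
    kind, and 3 otherwise. They are written as one polynomial in the indicators, so that averaging
    yields a polynomial in the masses. *)
Lemma nine0_base x y : tight x -> tight y ->
  nine 0 x y <= 3 + 2 * (spike x)%:R * (spike y)%:R
   + (halves x)%:R * (halves y)%:R
   - (halves x)%:R * (1 - (halves y)%:R - (spike y)%:R)
   - (1 - (halves x)%:R - (spike x)%:R) * (halves y)%:R.
Proof.
move=> tx ty.
have excl z : spike z -> halves z = false.
  case: z => [[z1 z2] z3] /andP[/eqP -> /eqP ->]; apply/negP => /andP[/eqP h _].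
  by move: h; lra.
have [sx|nx] := boolP (spike x).
  have := nine0_spike tx ty sx; rewrite (excl _ sx).
  by case: (boolP (spike y)) => [sy|ny]; rewrite ?(excl _ sy) /= => *; lra.
have [sy|ny] := boolP (spike y).
  have := nine0_spike ty tx sy; rewrite nineC (excl _ sy) (negbTE nx) /= => *; lra.
have [hx|nhx] := boolP (halves x).
  have := nine0_halves tx ty hx ny; case: (halves y) => /= *; lra.
have [hy|nhy] := boolP (halves y).
  have := nine0_halves ty tx hy nx; rewrite nineC (negbTE nhx) /= => *; lra.
have := nine0_generic tx ty nx ny; rewrite (negbTE nhx) /= => /(_ isT); lra.
Qed.

(** The largest entry of an inner triple is at most [1/3 + a < 2/3] and its smallest at most [1/3],
    so no cell with a smallest entry is good; [(x2, y2)] fails too, and [(x2, y3)] excludes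
    [(x3, y2)]. *)
Lemma nine0_inner a x y : a < 1/3 -> tight x -> tight y ->
  inner a x -> inner a y -> nine 0 x y <= 2.
Proof.
case: x => [[x1 x2] x3]; case: y => [[y1 y2] y3] al [x1p x12 x23 sx] [y1p y12 y23 sy].
rewrite /inner /nine => /andP[x1g hx] /andP[y1g hy].
have x3l : x3 <= 1/3 + a by case/orP: hx => ?; lra.
have y3l : y3 <= 1/3 + a by case/orP: hy => ?; lra.
kill (0 : R) x1 y1; kill (0 : R) x1 y2; kill (0 : R) x2 y1.
kill (0 : R) x1 y3; kill (0 : R) x3 y1; kill (0 : R) x2 y2.
have := @cell_excl2 0 x2 y3 x3 y2 ltac:(lra).
by bounds (0 : R).
Qed.

Lemma nine0_flat x y : tight x -> tight y -> flat x -> flat y -> nine 0 x y = 0.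
Proof.
case: x => [[x1 x2] x3]; case: y => [[y1 y2] y3] [x1p x12 x23 sx] [y1p y12 y23 sy].
rewrite /flat /nine => /eqP hx /eqP hy.
by rewrite !cell_eq0 ?addr0 //; lra.
Qed.

(** As before only the row of [x3] and the column of [y3] survive. If [y] is inner or outer, then
    [y3 < 1 - a] and the column adds nothing. *)
Lemma nineA_spike a x y : 0 <= a -> a < 1/3 -> tight x -> tight y -> spike x ->
  nine a x y <= 5 - 2 * ((inner a y)%:R + (outer a y)%:R).
Proof.
case: x => [[x1 x2] x3]; case: y => [[y1 y2] y3] a0 al [x1p x12 x23 sx] [y1p y12 y23 sy].
rewrite /spike /nine => /andP[/eqP ? /eqP ?]; subst x2 x3.
kill a x1 y1; kill a x1 y2; kill a (0 : R) y1; kill a (0 : R) y2.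
have [io|nio] := boolP (inner a (y1, y2, y3) || outer a (y1, y2, y3)).
  have y3l : y3 < 1 - a.
    by case/orP: io => /andP[_]; [case/orP|] => ?; lra.
  kill a x1 y3; kill a (0 : R) y3.
  have -> : (inner a (y1, y2, y3))%:R + (outer a (y1, y2, y3))%:R = 1 :> R.
    move: io; rewrite /inner /outer.
    by case: (ltrgtP y1 0) => h //=; [rewrite orbF|] => ->; rewrite ?addr0 ?add0r.
  by bounds a.
move: nio; rewrite negb_or => /andP[/negbTE -> /negbTE ->] /=.
by bounds a.
Qed.

(** Each of the three cyclic diagonals has total weight at most [2 < 3 - 3 * a], so at most 6 cells
    are good. If [(x2, y1)] or [(x1, y2)] is good, the inner and outer indicators already raise the
    right side to 6; otherwise three cells fail and the diagonal of [(x2, y2)] loses a further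
    one. *)
Lemma nineA_generic a x y : 0 <= a -> a < 1/3 -> tight x -> tight y ->
  ~~ spike x -> ~~ spike y ->
  nine a x y <= 5 + (inner a x)%:R * (inner a y)%:R
    + (inner a x)%:R * (outer a y)%:R + (outer a x)%:R * (inner a y)%:R.
Proof.
case: x => [[x1 x2] x3]; case: y => [[y1 y2] y3] a0 al [x1p x12 x23 sx] [y1p y12 y23 sy].
move=> nx ny.
have le6 : nine a (x1, x2, x3) (y1, y2, y3) <= 6.
  rewrite /nine.
  have := @cell_excl3 a x1 y1 x2 y2 x3 y3 ltac:(lra).
  have := @cell_excl3 a x1 y2 x2 y3 x3 y1 ltac:(lra).
  have := @cell_excl3 a x1 y3 x2 y1 x3 y2 ltac:(lra).
  by move=> *; lra.
have [c21|c21] := lerP (1 - a) (x2 + y1).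
  have -> : inner a (y1, y2, y3).
    by rewrite /inner; apply/andP; split; [|apply/orP; right]; lra.
  have : inner a (x1, x2, x3) || outer a (x1, x2, x3).
    rewrite /inner /outer; have -> : 2 / 3 - a <= x2 by lra.
    by rewrite !andbT; case: (ltrgtP x1 0) => //; lra.
  by case: (inner a (x1, x2, x3)); case: (outer a (x1, x2, x3));
    case: (outer a (y1, y2, y3)) => //= *; lra.
have [c12|c12] := lerP (1 - a) (x1 + y2).
  have -> : inner a (x1, x2, x3).
    by rewrite /inner; apply/andP; split; [|apply/orP; right]; lra.
  have : inner a (y1, y2, y3) || outer a (y1, y2, y3).
    rewrite /inner /outer; have -> : 2 / 3 - a <= y2 by lra.
    by rewrite !andbT; case: (ltrgtP y1 0) => //; lra.
  by case: (inner a (y1, y2, y3)); case: (outer a (x1, x2, x3));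
    case: (outer a (y1, y2, y3)) => //= *; lra.
suff : nine a (x1, x2, x3) (y1, y2, y3) <= 5.
  move=> h; apply: le_trans h _; rewrite -2![leRHS]addrA lerDl.
  by rewrite !addr_ge0 ?mulr_ge0 ?ler0n.
rewrite /nine; kill a x1 y1; kill a x1 y2; kill a x2 y1.
have := @cell_excl3 a x1 y3 x2 y2 x3 y1 ltac:(lra).
by bounds a.
Qed.

Lemma nineA a x y : 0 <= a -> a < 1/3 -> tight x -> tight y ->
  nine a x y <= 5 + (inner a x)%:R * (inner a y)%:R
    + (inner a x)%:R * (outer a y)%:R + (outer a x)%:R * (inner a y)%:R
    - 2 * (spike x)%:R * ((inner a y)%:R + (outer a y)%:R)
    - 2 * ((inner a x)%:R + (outer a x)%:R) * (spike y)%:R.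
Proof.
move=> a0 al tx ty.
have excl z : tight z -> spike z -> inner a z = false /\ outer a z = false.
  case: z => [[z1 z2] z3] [z1p z12 _ _] /andP[/eqP ? _]; subst z2.
  split; apply/negP => /andP[].
    by move=> ? /orP[] ?; lra.
  by move=> *; lra.
have [sx|nx] := boolP (spike x).
  have [-> ->] := excl _ tx sx.
  have := nineA_spike a0 al tx ty sx.
  by case: (boolP (spike y)) => [/(excl _ ty)[-> ->]|_] /= => *; lra.
have [sy|ny] := boolP (spike y).
  have [-> ->] := excl _ ty sy.
  by have := nineA_spike a0 al ty tx sy; rewrite nineC /= => *; lra.
by have := nineA_generic a0 al tx ty nx ny; rewrite /= => *; lra.
Qed.

End Kernel.

(** * Averaging the kernel over two independent random triples *)

Section KernelSum.
Variables (R : realFieldType) (I : finType) (mu : I -> R) (e : I -> R * R * R).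
Hypothesis mu_ge0 : forall i, 0 <= mu i.
Hypothesis mu_sum : \sum_i mu i = 1.
Hypothesis e_tight : forall i, 0 < mu i -> tight (e i).

Definition below (t : R) (x : R * R * R) : R :=
  let: (x1, x2, x3) := x in (x1 < t)%R%:R + (x2 < t)%R%:R + (x3 < t)%R%:R.

Let av (f : I -> R) : R := \sum_i mu i * f i.
Let av2 (f : I -> I -> R) : R := \sum_i \sum_j mu i * mu j * f i j.

Let av_ge0 f : (forall i, 0 <= f i) -> 0 <= av f.
Proof. by move=> f0; apply: sumr_ge0 => i _; rewrite mulr_ge0. Qed.

Let av_le f g : (forall i, 0 < mu i -> f i <= g i) -> av f <= av g.
Proof.
move=> fg; apply: ler_sum => i _.
have := mu_ge0 i; rewrite le_eqVlt => /predU1P[<-|mi]; first by rewrite !mul0r.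
by rewrite ler_pM2l // fg.
Qed.

Let av2_le f g : (forall i j, tight (e i) -> tight (e j) -> f i j <= g i j) ->
  av2 f <= av2 g.
Proof.
move=> fg; apply: ler_sum => i _; apply: ler_sum => j _.
have := mu_ge0 i; rewrite le_eqVlt => /predU1P[<-|mi]; first by rewrite !mul0r.
have := mu_ge0 j; rewrite le_eqVlt => /predU1P[<-|mj].
  by rewrite mulr0 !mul0r.
by rewrite ler_pM2l ?mulr_gt0 //; apply: fg; exact: e_tight.
Qed.

Let av2D f g : av2 (fun i j => f i j + g i j) = av2 f + av2 g.
Proof.
rewrite /av2 -big_split; apply: eq_bigr => i _; rewrite -big_split.
by apply: eq_bigr => j _; rewrite mulrDr.
Qed.

Let av2M c f g : av2 (fun i j => c * f i * g j) = c * av f * av g.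
Proof.
rewrite /av2 /av -mulrA big_distrlr /= mulr_sumr; apply: eq_bigr => i _.
by rewrite mulr_sumr; apply: eq_bigr => j _; ring.
Qed.

Let avD f g : av (fun i => f i + g i) = av f + av g.
Proof. by rewrite /av -big_split; apply: eq_bigr => i _; rewrite mulrDr. Qed.

Let avM c f : av (fun i => c * f i) = c * av f.
Proof. by rewrite /av mulr_sumr; apply: eq_bigr => i _; rewrite mulrCA. Qed.

Let av1 : av (fun=> 1) = 1.
Proof. by rewrite /av -[RHS]mu_sum; apply: eq_bigr => i _; rewrite mulr1. Qed.

Let one : I -> R := fun=> 1.
Let s i : R := (spike (e i))%:R.
Let h i : R := (halves (e i))%:R.
Let f i : R := (flat (e i))%:R.
Let n a i : R := (inner a (e i))%:R.
Let o a i : R := (outer a (e i))%:R.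

Let classes i : s i + h i <= 1.
Proof.
rewrite /s /h; case: (e i) => [[x1 x2] x3].
have [/andP[/eqP -> /eqP ->]|_] := boolP (spike _); last first.
  by rewrite /= add0r lern1 leq_b1.
have -> : halves (x1, 0 : R, 1 : R) = false by apply/negP => /andP[/eqP ? _]; lra.
by rewrite addr0.
Qed.

(** Let [p] and [r] be the masses of spikes and [halves]. A spike has two zero entries and [halves]
    one, so the counts of entries below [b] and [a] bound [2 * p + r]. Then [halves] cannot help,
    the average of [nine 0] is at most [3 + 2 * p ^+ 2], and an average of [nine a] above 5 forces a
    loss larger than this surplus. *)
Lemma no_bad_cover (a b g : R) :
  0 <= b -> b <= a -> 0 < g -> g <= 1/3 ->
  3 + 9 * g <= \sum_i \sum_j mu i * mu j * nine 0 (e i) (e j) ->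
  4 < \sum_i \sum_j mu i * mu j * nine b (e i) (e j) ->
  5 < \sum_i \sum_j mu i * mu j * nine a (e i) (e j) ->
  (0 < b -> \sum_i mu i * below b (e i) <= 3/5) ->
  (0 < a -> \sum_i mu i * below a (e i) <= 1 + g) ->
  False.
Proof.
move=> b0 ba g0 g1 N0 Nb Na cb ca.
rewrite -!/(av2 _) -!/(av _) in N0 Nb Na cb ca.
pose p := av s; pose r := av h.
have p0 : 0 <= p by apply: av_ge0 => i; exact: ler0n.
have r0 : 0 <= r by apply: av_ge0 => i; exact: ler0n.
have pr : p + r <= 1.
  by rewrite /p /r -avD -av1; apply: av_le => i _; exact: classes.
have base F : (forall i j, tight (e i) -> tight (e j) ->
     nine 0 (e i) (e j) <= 3 + 2 * s i * s j + h i * h j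
       - h i * (1 - h j - s j) - (1 - h i - s i) * h j - 3 * F i * F j) ->
     av2 (fun i j => nine 0 (e i) (e j)) <=
     3 + 2 * p ^+ 2 + r ^+ 2 - 2 * r * (1 - r - p) - 3 * av F ^+ 2.
  move=> hF; apply: le_trans (_ : av2 (fun i j => 3 * one i * one j
    + (2 * s i * s j + (3 * h i * h j + ((-1) * h i * one j +
      ((-1) * one i * h j + (1 * h i * s j + (1 * s i * h j +
       (-3) * F i * F j))))))) <= _).
    apply: av2_le => i j ti tj; apply: le_trans (hF i j ti tj) _.
    by rewrite le_eqVlt; apply/orP; left; apply/eqP; rewrite /one; ring.
  rewrite !av2D !av2M av1 -!/p -!/r.
  by rewrite le_eqVlt; apply/orP; left; apply/eqP; ring.
have base0 : av2 (fun i j => nine 0 (e i) (e j)) <=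
     3 + 2 * p ^+ 2 + r ^+ 2 - 2 * r * (1 - r - p).
  have av0 : av (fun=> 0) = 0.
    by rewrite /av big1 // => i _; rewrite mulr0.
  suff : av2 (fun i j => nine 0 (e i) (e j)) <=
      3 + 2 * p ^+ 2 + r ^+ 2 - 2 * r * (1 - r - p) - 3 * av (fun=> 0) ^+ 2.
    by rewrite av0 => H; lra.
  apply: base => i j ti tj; have := nine0_base ti tj.
  by rewrite -!/(s _) -!/(h _) => H; lra.
(* For [a = 0] the third average is one of [nine 0], and [base0] keeps it at most 5 because
   [p + r <= 1]. *)
have [a0|a0] := leP a 0.
  have aE : a = 0 by lra.
  by move: Na; rewrite aE; nra.
have count t : 0 < t -> 2 * p + r <= av (fun i => below t (e i)).
  move=> t0; rewrite /p /r -avM -avD; apply: av_le => i /e_tight.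
  rewrite /s /h; case: (e i) => [[x1 x2] x3] [x1p x12 x23 sx].
  rewrite /spike /halves /below.
  have [/andP[/eqP ? /eqP ?]|_] := boolP (_ && (x3 == 1)).
    subst x2 x3; have -> : (0 == 1/2 :> R) = false by apply/eqP; lra.
    have -> : x1 < t by lra.
    by rewrite t0 /=; have := ler0n R (1 < t)%R; lra.
  have [/andP[/eqP ? /eqP ?]|_] := boolP (_ && _).
    subst x2 x3; have -> : x1 < t by lra.
    by have := ler0n R (1/2 < t)%R; rewrite /=; lra.
  by rewrite mulr0 addr0 !addr_ge0 ?ler0n.
have pra := le_trans (count a a0) (ca a0).
(* For [b = 0] the second average is one of [nine 0]; with [p + r <= 1] and [2 * p + r <= 4/3],
   [base0] keeps it at most 4. *)
have [b0'|bp] := leP b 0.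
  have bE : b = 0 by lra.
  by move: Nb; rewrite bE; nra.
have prb := le_trans (count b bp) (cb bp).
(* Here [2 * p + 3 * r] is at most three times [2 * p + r], hence at most 9/5. *)
have r_ok : 0 <= r * (2 - 2 * p - 3 * r) by rewrite mulr_ge0 //; lra.
(* For a < 1/3, exceeding 5 on average forces the inner mass y above 2 p, which
   lowers the average of [nine 0] below 3.  For a >= 1/3 the flat edges have mass
   at least p - g, with the same effect. *)
have [a13|a13] := ltP a (1/3).
  pose y := av (n a); pose t := av (o a).
  have y0 : 0 <= y by apply: av_ge0 => i; exact: ler0n.
  have t0 : 0 <= t by apply: av_ge0 => i; exact: ler0n.
  have Na' : av2 (fun i j => nine a (e i) (e j)) <=
      5 + y ^+ 2 + 2 * y * t - 4 * p * (y + t).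
    apply: le_trans (_ : av2 (fun i j => 5 * one i * one j
      + (1 * n a i * n a j + (1 * n a i * o a j + (1 * o a i * n a j +
      ((-2) * s i * n a j + ((-2) * s i * o a j + ((-2) * n a i * s j +
       (-2) * o a i * s j))))))) <= _).
      apply: av2_le => i j ti tj; apply: le_trans (nineA (ltW a0) a13 ti tj) _.
      by rewrite le_eqVlt; apply/orP; left; apply/eqP; rewrite /one /s /n /o; ring.
    rewrite !av2D !av2M av1 -!/p -!/y -!/t.
    by rewrite le_eqVlt; apply/orP; left; apply/eqP; ring.
  have N0' : av2 (fun i j => nine 0 (e i) (e j)) <=
     3 + 2 * p ^+ 2 + r ^+ 2 - 2 * r * (1 - r - p) - y ^+ 2.
    apply: le_trans (_ : av2 (fun i j => 3 * one i * one j
      + (2 * s i * s j + (3 * h i * h j + ((-1) * h i * one j +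
      ((-1) * one i * h j + (1 * h i * s j + (1 * s i * h j +
       (-1) * n a i * n a j))))))) <= _).
      apply: av2_le => i j ti tj.
      have sh k : tight (e k) -> inner a (e k) -> s k = 0 /\ h k = 0.
        rewrite /s /h; case: (e k) => [[x1 x2] x3] [_ x12 x23 sx] /andP[x1p _].
        rewrite /spike /halves; split.
          by have -> : (x2 == 0) = false by apply/eqP; lra.
        have [/andP[/eqP ? /eqP ?]|//] := boolP (_ && _); lra.
      have := nine0_base ti tj; rewrite -!/(s _) -!/(h _) => H.
      have [ni|ni] := boolP (inner a (e i)); last first.
        apply: le_trans H _; rewrite /n (negbTE ni) /= /one.
        by rewrite le_eqVlt; apply/orP; left; apply/eqP; ring.
      have [nj|nj] := boolP (inner a (e j)); last first.
        apply: le_trans H _; rewrite /n (negbTE nj) /= /one.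
        by rewrite le_eqVlt; apply/orP; left; apply/eqP; ring.
      have [-> ->] := sh _ ti ni; have [-> ->] := sh _ tj nj.
      have := nine0_inner a13 ti tj ni nj.
      by rewrite /n ni nj /one /=; lra.
    rewrite !av2D !av2M av1 -!/p -!/r -!/y.
    by rewrite le_eqVlt; apply/orP; left; apply/eqP; ring.
  (* [Na] and [Na'] give [4 * p * (y + t) < y ^+ 2 + 2 * y * t], which is at most
     [2 * y * (y + t)]. *)
  have yp : y < 2 * p by nra.
  nra.
pose k := av f.
(* A triple that is not flat has an entry below [1/3 <= a], and a spike has two, so the count of
   entries below [a] is at least [1 + p - k]. *)
have kp : p - g <= k.
  have : 1 + p - k <= av (fun i => below a (e i)).
    rewrite /p /k -av1 -avD -[- av _]mulN1r -avM -avD.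
    apply: av_le => i /e_tight; rewrite /s /f.
    case: (e i) => [[x1 x2] x3] [x1p x12 x23 sx]; rewrite /spike /flat /below.
    have [/eqP ?|x1n] := boolP (x1 == 1/3).
      subst x1.
      have [/andP[/eqP ? /eqP ?]|_] := boolP (_ && _); first by lra.
      have : (0 : R) <= (1/3 < a)%R%:R + (x2 < a)%R%:R + (x3 < a)%R%:R.
        by rewrite !addr_ge0 ?ler0n.
      by rewrite /=; lra.
    have -> : x1 < a.
      apply: lt_le_trans a13; rewrite lt_neqAle x1n /=; lra.
    have := ler0n R (x3 < a)%R.
    have [/andP[/eqP ? /eqP ?]|_] := boolP (_ && _).
      by subst x2; rewrite a0 /=; lra.
    by have := ler0n R (x2 < a)%R; rewrite /=; lra.
  have := ca a0; lra.
have N0' := @base f _.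
have {}N0' : av2 (fun i j => nine 0 (e i) (e j)) <=
    3 + 2 * p ^+ 2 + r ^+ 2 - 2 * r * (1 - r - p) - 3 * k ^+ 2.
  apply: N0' => i j ti tj.
  have sh l : tight (e l) -> flat (e l) -> s l = 0 /\ h l = 0.
    rewrite /s /h; case: (e l) => [[x1 x2] x3] [_ x12 x23 sx] /eqP ?; subst x1.
    rewrite /spike /halves; split.
      by have -> : (x2 == 0) = false by apply/eqP; lra.
    by have [/andP[/eqP ? /eqP ?]|//] := boolP (_ && _); lra.
  have := nine0_base ti tj; rewrite -!/(s _) -!/(h _) => H.
  have [fi|fi] := boolP (flat (e i)); last first.
    by apply: le_trans H _; rewrite /f (negbTE fi) /= ?mulr0 ?mul0r subr0.
  have [fj|fj] := boolP (flat (e j)); last first.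
    by apply: le_trans H _; rewrite /f (negbTE fj) /= ?mulr0 ?mul0r subr0.
  have [-> ->] := sh _ ti fi; have [-> ->] := sh _ tj fj.
  have := nine0_flat ti tj fi fj.
  by rewrite /f fi fj /=; lra.
(* For [p > g] the surplus is at most [2 * p ^+ 2 - 3 * (p - g) ^+ 2 <= 6 * g ^+ 2], and for
   [p <= g] at most [2 * g ^+ 2]. Both are below the required [9 * g], as [g <= 1/3]. *)
have [pg|pg] := leP p g; nra.
Qed.

End KernelSum.

(** * Fractional perfect matchings *)

Section Links.
Variables (V : finType) (H : graph3 V).
Implicit Types (U e : {set V}) (v x y z : V).

Definition adj v x y : bool := [set v; x; y] \in edges H.

(* Ordered pairs: this is twice the number of edges {v, x, y} with x, y in U. *)
Definition links U v : nat := (\sum_(x in U) \sum_(y in U) adj v x y)%N.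

Lemma adj_neq v x y : adj v x y -> [/\ v != x, v != y & x != y].
Proof.
move=> /card_edge; rewrite -setUA cardsU1 cards2 !inE.
by do 3 case: eqP.
Qed.

Lemma adjC v x y : adj v x y = adj v y x.
Proof. by rewrite /adj setUAC. Qed.

Lemma sum_set3 (R : nmodType) (f : V -> R) x y z : x != y -> x != z -> y != z ->
  \sum_(v in [set x; y; z]) f v = f x + f y + f z.
Proof.
move=> xy xz yz; rewrite -setUA big_setU1 ?inE ?negb_or ?xy //=.
by rewrite big_setU1 ?inE //= big_set1 addrA.
Qed.

Lemma sorted_triple (R : realDomainType) (w : V -> R) e : #|e| = 3%N ->
  exists t : V * V * V, [/\ e = [set t.1.1; t.1.2; t.2],
    t.1.1 != t.1.2, t.1.1 != t.2, t.1.2 != t.2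
    & (w t.1.1 <= w t.1.2) && (w t.1.2 <= w t.2)].
Proof.
move=> e3.
have eE : e =i sort (fun x y => w x <= w y) (enum e).
  by move=> v; rewrite mem_sort mem_enum.
have : uniq (sort (fun x y => w x <= w y) (enum e)) by rewrite sort_uniq enum_uniq.
have : sorted (fun x y => w x <= w y) (sort (fun x y => w x <= w y) (enum e)).
  by apply: sort_sorted => x y; exact: le_total.
have : size (sort (fun x y => w x <= w y) (enum e)) = 3%N by rewrite size_sort -cardE.
case: (sort _ _) eE => [|x [|y [|z []]]] //= eE _ /and3P[xy yz _].
rewrite !inE negb_or -!andbA => /and4P[nxy nxz nyz _].
exists (x, y, z); split => //=; last by rewrite xy.
by apply/setP => v; rewrite eE !inE orbA.
Qed.

End Links.

Section Fractional.
Variables (R : realFieldType) (V : finType) (H : graph3 V).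

Lemma frac_pm (U Q S : {set V}) (g : R) :
  0 < g -> g <= 1/3 -> (0 < #|U|)%N -> Q \subset S ->
  (forall v, v \in U -> (1/3 + g) * #|U|%:R ^+ 2 <= (links H U v)%:R) ->
  (forall v, v \in U -> v \notin Q ->
     (4/9 + g) * #|U|%:R ^+ 2 <= (links H U v)%:R) ->
  (forall v, v \in U -> v \notin S ->
     (5/9 + g) * #|U|%:R ^+ 2 <= (links H U v)%:R) ->
  #|U :&: Q|%:R <= 1/5 * #|U|%:R :> R ->
  #|U :&: S|%:R <= (1/3 + g/3) * #|U|%:R :> R ->
  exists x : {set V} -> R, [/\ forall e, 0 <= x e,
    forall e, x e != 0 -> (e \in edges H) && (e \subset U)
    & forall v, v \in U -> \sum_(e : {set V} | v \in e) x e = 1].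
Proof.
move=> g0 g1 U0 QS D0 DQ DS cQ cS.
pose E := [set e in edges H | e \subset U].
have E3 e : e \in E -> #|e| = 3%N by rewrite inE => /andP[/card_edge].
have EU e : e \in E -> e \subset U by rewrite inE => /andP[].
have [|w [x [w0 x0 wE xU wx]]] := @matching_cover_duality R V U E.
  by move=> e eE; split; [rewrite -card_gt0 E3|exact: EU].
pose u : R := #|U|%:R.
have u0 : 0 < u by rewrite /u ltr0n.
have swap (f : V -> R) : \sum_(e in E) x e * (\sum_(v in e) f v) =
    \sum_(v in U) f v * (\sum_(e in E | v \in e) x e).
  rewrite (eq_bigr (fun e : {set V} => \sum_(v in U) if v \in e then f v * x e else 0)).
    rewrite exchange_big /=; apply: eq_bigr => v _.
    by rewrite mulr_sumr -big_mkcondr.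
  move=> e eE; rewrite mulr_sumr big_mkcond [RHS]big_mkcond /=.
  apply: eq_bigr => v _; have [ve|_] := boolP (v \in e); last by rewrite if_same.
  by rewrite (subsetP (EU _ eE)) // mulrC.
pose sl v : R := 1 - \sum_(e in E | v \in e) x e.
have sl0 v : v \in U -> 0 <= sl v by move=> vU; rewrite /sl subr_ge0 xU.
have sl_sum : \sum_(v in U) sl v = u - 3 * \sum_(e in E) x e.
  rewrite /sl big_split /= sumr_const sumrN; congr (_ - _).
  transitivity (\sum_(e in E) x e * \sum_(v in e) 1).
    by rewrite swap; apply: eq_bigr => v _; rewrite mul1r.
  rewrite mulr_sumr; apply: eq_bigr => e eE.
  by rewrite sumr_const (E3 _ eE) mulrC.
have [sx|sx] := leP (u / 3) (\sum_(e in E) x e).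
  have slz v : v \in U -> sl v = 0.
    have /eqP : \sum_(v in U) sl v = 0.
      by apply/le_anti/andP; split; [rewrite sl_sum; lra|exact: sumr_ge0].
    by rewrite psumr_eq0 // => /allP /(_ v); rewrite mem_index_enum => /(_ isT)
      /implyP h /h /eqP.
  exists (fun e => if e \in E then x e else 0); split.
  - by move=> e; case: ifP.
  - by move=> e; case: ifP => [|_]; [rewrite inE|rewrite eqxx].
  - move=> v vU; have /eqP := slz v vU; rewrite subr_eq0 eq_sym => /eqP <-.
    by rewrite -big_mkcondl; apply: eq_bigl => e; rewrite andbC.
exfalso.
(* Complementary slackness: the gap between cover and matching splits into two nonnegative sums, so
   each of their terms is zero. *)
have cs : \sum_(v in U) w v * sl v + \sum_(e in E) x e * (\sum_(v in e) w v - 1) <= 0.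
  rewrite (eq_bigr (fun v => w v - w v * \sum_(e in E | v \in e) x e)) => [|v _].
    rewrite big_split sumrN /= -swap.
    rewrite [X in _ + X](eq_bigr (fun e : {set V} => x e * (\sum_(v in e) w v) - x e)) => [|e _].
      by rewrite big_split sumrN /=; lra.
    by rewrite mulrBr mulr1.
  by rewrite /sl mulrBr mulr1.
have cs1 : 0 <= \sum_(v in U) w v * sl v.
  by apply: sumr_ge0 => v vU; rewrite mulr_ge0 // sl0.
have cs2 : 0 <= \sum_(e in E) x e * (\sum_(v in e) w v - 1).
  by apply: sumr_ge0 => e eE; rewrite mulr_ge0 // subr_ge0 wE.
have csV v : v \in U -> 0 < sl v -> w v = 0.
  move=> vU slv; have /eqP : \sum_(v in U) w v * sl v = 0 by lra.
  rewrite psumr_eq0 => [/allP/(_ v)|z zU]; last by rewrite mulr_ge0 // sl0.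
  rewrite mem_index_enum vU => /(_ isT) /=; rewrite mulf_eq0 => /orP[/eqP //|/eqP h].
  by rewrite h ltxx in slv.
have csE e : e \in E -> 0 < x e -> \sum_(v in e) w v = 1.
  move=> eE xe; have /eqP : \sum_(e in E) x e * (\sum_(v in e) w v - 1) = 0 by lra.
  rewrite psumr_eq0 => [/allP/(_ e)|z zU]; last by rewrite mulr_ge0 // subr_ge0 wE.
  rewrite mem_index_enum eE => /(_ isT) /=; rewrite mulf_eq0 subr_eq0.
  by move=> /orP[/eqP h|/eqP //]; rewrite h ltxx in xe.
(* The matching is not perfect, so some vertex is unsaturated and has weight 0. It supplies the
   threshold [t = 0]. *)
have [v0 v0U wv0] : exists2 v, v \in U & w v = 0.
  have [/existsP[v /andP[vU slv]]|/existsPn no] := boolP [exists v, (v \in U) && (0 < sl v)].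
    by exists v => //; exact: csV.
  have : \sum_(v in U) sl v <= 0.
    by apply: sumr_le0 => v vU; have := no v; rewrite vU /= -leNgt.
  rewrite sl_sum; lra.
pose tri (e : {set V}) : V * V * V :=
  odflt (v0, v0, v0) [pick t : V * V * V | [&& e == [set t.1.1; t.1.2; t.2],
    t.1.1 != t.1.2, t.1.1 != t.2, t.1.2 != t.2
    & (w t.1.1 <= w t.1.2) && (w t.1.2 <= w t.2)]].
have triP e : e \in E -> [/\ e = [set (tri e).1.1; (tri e).1.2; (tri e).2],
    (tri e).1.1 != (tri e).1.2, (tri e).1.1 != (tri e).2, (tri e).1.2 != (tri e).2
    & (w (tri e).1.1 <= w (tri e).1.2) && (w (tri e).1.2 <= w (tri e).2)].
  move=> /E3 e3; rewrite /tri; case: pickP => [t /and5P[/eqP]//|no].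
  have [t [h1 h2 h3 h4 h5]] := sorted_triple w e3.
  by have := no t; rewrite -h1 eqxx h2 h3 h4 h5.
pose I := ({set V} + V)%type.
(* A random edge of the matching, or a random unsaturated vertex taken three times. Load and slack
   at a vertex add up to 1, so a random entry of a random triple is uniform on [U]; this is
   [muT]. *)
pose mu (i : I) : R := match i with
  | inl e => if e \in E then 3 * x e / u else 0
  | inr v => if v \in U then sl v / u else 0 end.
pose T (i : I) : V * V * V := match i with inl e => tri e | inr v => (v, v, v) end.
pose e (i : I) : R * R * R := (w (T i).1.1, w (T i).1.2, w (T i).2).
have mu0 i : 0 <= mu i.
  case: i => [f|v] /=; case: ifP => // h; rewrite divr_ge0 ?(ltW u0) //.
    by rewrite mulr_ge0.
  exact: sl0.
have muT (f : V -> R) : \sum_i mu i * (f (T i).1.1 + f (T i).1.2 + f (T i).2) =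
    3 / u * \sum_(v in U) f v.
  rewrite big_sumType /=.
  transitivity (3 / u * \sum_(e in E) x e * (\sum_(v in e) f v)
                + 3 / u * \sum_(v in U) f v * sl v).
    congr (_ + _); rewrite mulr_sumr [RHS]big_mkcond; apply: eq_bigr => i _.
      case: ifP => iE; last by rewrite mul0r.
      have [iE' h1 h2 h3 _] := triP i iE.
      have -> : \sum_(v in i) f v = f (tri i).1.1 + f (tri i).1.2 + f (tri i).2.
        by rewrite {1}iE' sum_set3.
      by rewrite /=; ring.
    by case: ifP => iE; rewrite ?mul0r //; ring.
  rewrite swap -mulrDr -big_split /=; congr (_ * _); apply: eq_bigr => v _.
  by rewrite /sl; ring.
have mu1 : \sum_i mu i = 1.
  have := muT (fun=> 1); rewrite sumr_const -/u -mulr_suml => h.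
  by rewrite divfK ?gt_eqF // in h; lra.
have eT i : 0 < mu i -> tight (e i).
  case: i => [f|v] /=; case: ifP => h; rewrite ?ltxx //.
    have [fE h1 h2 h3 /andP[h4 h5]] := triP f h.
    rewrite pmulr_lgt0 ?invr_gt0 // pmulr_rgt0 // => xf.
    have := csE _ h xf; rewrite {1}fE sum_set3 // => s1.
    by split; rewrite ?w0 ?s1.
  rewrite pmulr_lgt0 ?invr_gt0 // => /csV -> //.
  by split; rewrite ?addr0 ?ler01.
have nineE t : \sum_i \sum_j mu i * mu j * nine t (e i) (e j) =
    9 / u ^+ 2 * \sum_(y in U) \sum_(z in U) cell t (w y) (w z).
  transitivity (\sum_i mu i * (3 / u * \sum_(z in U)
      (cell t (w (T i).1.1) (w z) + cell t (w (T i).1.2) (w z)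
       + cell t (w (T i).2) (w z)))).
    apply: eq_bigr => i _; rewrite -muT mulr_sumr; apply: eq_bigr => j _.
    by rewrite /nine /e; ring.
  transitivity (3 / u * (3 / u * \sum_(y in U) \sum_(z in U) cell t (w y) (w z)));
    last by field; rewrite gt_eqF.
  rewrite -muT mulr_sumr; apply: eq_bigr => i _.
  by rewrite !big_split /=; ring.
have belowE t : \sum_i mu i * below t (e i) =
    3 / u * \sum_(y in U) (w y < t)%R%:R.
  by rewrite -muT.
(* An edge [{v, y, z}] inside [U] has cover weight at least 1, so the pair [(y, z)] has weight at
   least [1 - w v]. *)
have linksE v : v \in U ->
    (links H U v)%:R <= \sum_(y in U) \sum_(z in U) cell (w v) (w y) (w z).
  move=> vU; rewrite /links natr_sum; apply: ler_sum => y yU.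
  rewrite natr_sum; apply: ler_sum => z zU; rewrite /cell ler_nat.
  have [a|//] := boolP (adj H v y z); have [vy vz yz] := adj_neq a.
  have /wE : [set v; y; z] \in E.
    rewrite /adj in a; rewrite inE a.
    by apply/subsetP => k; rewrite !inE => /orP[/orP[]|] /eqP ->.
  rewrite sum_set3 // => h; have -> // : 1 - w v <= w y + w z by clear -h; lra.
have nine_ge c v : v \in U -> c * #|U|%:R ^+ 2 <= (links H U v)%:R ->
    9 * c <= \sum_i \sum_j mu i * mu j * nine (w v) (e i) (e j).
  move=> vU h; rewrite nineE mulrAC ler_pdivlMr ?exprn_gt0 // -mulrA ler_pM2l //.
  exact: le_trans h (linksE v vU).
have argmin (A : {set V}) : (#|U :&: A|%:R < u)%R -> exists v, [/\ v \in U, v \notin A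
    & forall z, z \in U -> z \notin A -> w v <= w z].
  move=> hA; have [v1 v1P] : exists v1, (v1 \in U) && (v1 \notin A).
    apply/existsP; apply: contraLR hA => /existsPn no; rewrite -leNgt.
    rewrite (_ : U :&: A = U) //; apply/setIidPl/subsetP => z zU.
    by have := no z; rewrite zU negbK.
  case: (@arg_minP _ _ _ v1 (fun v => (v \in U) && (v \notin A)) w v1P) => v.
  move=> /andP[vU vA] vmin; exists v; split => // z zU zA.
  by apply: vmin; rewrite zU.
have [va [vaU vaS va_min]] : exists v, [/\ v \in U, v \notin S
    & forall z, z \in U -> z \notin S -> w v <= w z].
  by apply: argmin; nra.
have [vb [vbU vbQ vb_min]] : exists v, [/\ v \in U, v \notin Q
    & forall z, z \in U -> z \notin Q -> w v <= w z].
  by apply: argmin; nra.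
have belowS (A : {set V}) t : (forall z, z \in U -> z \notin A -> t <= w z) ->
    \sum_i mu i * below t (e i) <= 3 / u * #|U :&: A|%:R.
  move=> ht; rewrite belowE ler_pM2l ?divr_gt0 //.
  rewrite -sum1_card natr_sum big_mkcond [leRHS]big_mkcond /=.
  apply: ler_sum => z _; rewrite inE; case: ifP => //= zU.
  have [zA|zA] := boolP (z \in A); first by rewrite lern1 leq_b1.
  by rewrite ltNge ht.
apply: (@no_bad_cover R I mu e mu0 mu1 eT (w va) (w vb) g) => //.
- apply: vb_min => //; apply: contra vaS; exact: (subsetP QS).
- have := nine_ge _ v0 v0U (D0 _ v0U); rewrite wv0; apply: le_trans; clear; lra.
- apply: lt_le_trans (nine_ge _ _ vbU (DQ _ vbU vbQ)); clear -g0; lra.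
- apply: lt_le_trans (nine_ge _ _ vaU (DS _ vaU vaS)); clear -g0; lra.
- move=> _; apply: le_trans (belowS Q _ vb_min) _.
  by rewrite mulrAC ler_pdivrMr //; rewrite -/u in cQ; clear -cQ; lra.
- move=> _; apply: le_trans (belowS S _ va_min) _.
  by rewrite mulrAC ler_pdivrMr //; rewrite -/u in cS; clear -cS; lra.
Qed.

End Fractional.

(** * Removing edges one at a time *)

(** From [1 - x <= expR (- x)] and [(1 + x + 2 * x ^+ 2) * (1 - x) = 1 + x ^+ 2 * (1 - 2 * x)],
    which is at least 1 for [x <= 1/2]. *)
Lemma expR_le_quadratic (R : realType) (x : R) :
  `|x| <= 1/2 -> expR x <= 1 + x + 2 * x ^+ 2.
Proof.
rewrite ler_norml => /andP[x1 x2].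
have h : 1 - x <= expR (- x) by exact: expR_ge1Dx.
have e0 := expR_gt0 x.
have : expR x * (1 - x) <= 1.
  by rewrite -[leRHS](expRxMexpNx_1 x) ler_pM2l.
nra.
Qed.

(** On expanding each exponential to second order, the linear terms average to something
    nonpositive, so some [e] in the support of [x] does at least as well as the average. *)
Lemma exp_average (R : realType) (K J : finType) (x : J -> R) (phi : K -> R)
    (d : K -> J -> R) (th : R) :
  (forall e, 0 <= x e) -> 0 < \sum_e x e -> (forall k, 0 <= phi k) ->
  th <= 1/2 -> (forall k e, x e != 0 -> `|d k e| <= th) ->
  (forall k, \sum_e x e * d k e <= 0) ->
  exists2 e, x e != 0 &
    \sum_k phi k * expR (d k e) <= (1 + 2 * th ^+ 2) * \sum_k phi k.
Proof.
move=> x0 sx phi0 th1 dth dx.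
apply: contrapT => no.
have {}no e : x e != 0 ->
    (1 + 2 * th ^+ 2) * \sum_k phi k < \sum_k phi k * expR (d k e).
  by move=> xe; rewrite ltNge; apply/negP => h; apply: no; exists e.
have supp (G : J -> R) : \sum_e x e * G e = \sum_(e | x e != 0) x e * G e.
  by rewrite [RHS]big_mkcond; apply: eq_bigr => e _; case: eqP => //= ->; rewrite mul0r.
have [e0 xe0] : exists e, x e != 0.
  apply: contrapT => all0; move: sx; rewrite big1 ?ltxx // => e _.
  by apply/eqP/negPn/negP => xe; apply: all0; exists e.
have : \sum_(e | x e != 0) x e * ((1 + 2 * th ^+ 2) * \sum_k phi k)
       < \sum_(e | x e != 0) x e * \sum_k phi k * expR (d k e).
  apply: ltr_sum => [|e xe]; first by apply/hasP; exists e0; rewrite ?mem_index_enum.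
  by rewrite ltr_pM2l ?no // lt_neqAle eq_sym xe x0.
rewrite -!supp; apply/negP; rewrite -leNgt.
apply: (@le_trans _ _ (\sum_e x e * \sum_k phi k * (1 + d k e + 2 * th ^+ 2))).
  rewrite !supp; apply: ler_sum => e xe; rewrite ler_wpM2l //.
  apply: ler_sum => k _; rewrite ler_wpM2l //.
  have dk := dth k e xe; apply: le_trans (expR_le_quadratic (le_trans dk th1)) _.
  by rewrite lerD2l ler_pM2l // -real_normK ?num_real // lerXn2r ?nnegrE // (le_trans _ dk).
rewrite -mulr_suml.
have -> : \sum_e x e * \sum_k phi k * (1 + d k e + 2 * th ^+ 2) =
   (\sum_e x e) * ((1 + 2 * th ^+ 2) * \sum_k phi k)
   + \sum_k phi k * \sum_e x e * d k e.
  rewrite [X in _ + X](eq_bigr (fun k => \sum_e x e * (phi k * d k e))) => [|k _].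
    rewrite exchange_big /= mulr_suml -big_split /=; apply: eq_bigr => e _.
    rewrite [\sum_k x e * _](_ : _ = x e * \sum_k phi k * d k e); last first.
      by rewrite mulr_sumr; apply: eq_bigr => k _; ring.
    rewrite -mulrDr; congr (_ * _); rewrite mulr_sumr -big_split /=.
    by apply: eq_bigr => k _ /=; ring.
  by rewrite mulr_sumr; apply: eq_bigr => e _; ring.
rewrite gerDl; apply: sumr_le0 => k _; exact: mulr_ge0_le0.
Qed.

Section Process.
Variables (R : realType) (V : finType) (H : graph3 V).
Implicit Types (U W e A : {set V}) (v a : V).

Definition matched U : Prop := exists M : {set {set V}},
  [/\ M \subset edges H, trivIset M & cover M = U].

Lemma matched0 : matched set0.
Proof.
exists set0; split; rewrite ?sub0set ?/cover ?big_set0 //.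
by apply/trivIsetP => A B; rewrite inE.
Qed.

Lemma matched_edge e : e \in edges H -> matched e.
Proof.
move=> eH; exists [set e]; split; rewrite ?sub1set // /cover ?big_set1 //.
by apply/trivIsetP => A B; rewrite !inE => /eqP -> /eqP ->; rewrite eqxx.
Qed.

Lemma matchedU U W : [disjoint U & W] -> matched U -> matched W -> matched (U :|: W).
Proof.
move=> dUW [M [ME Mt Mc]] [N [NE Nt Nc]]; exists (M :|: N); split.
- by rewrite subUset ME.
- apply/trivIsetP => A B; rewrite !inE.
  have sM C : C \in M -> C \subset U by rewrite -Mc => CM; exact: bigcup_sup.
  have sN C : C \in N -> C \subset W by rewrite -Nc => CN; exact: bigcup_sup.
  case/orP=> AM /orP[] BM AB.
  + exact: (trivIsetP Mt).
  + exact: disjointW (sM _ AM) (sN _ BM) dUW.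
  + by rewrite disjoint_sym; exact: disjointW (sM _ BM) (sN _ AM) dUW.
  + exact: (trivIsetP Nt).
- by rewrite /cover bigcup_setU -!/(cover _) Mc Nc.
Qed.

Definition nbrs U v a : nat := (\sum_(y in U) adj H v a y)%N.

Lemma links_le U v : (links H U v <= #|U| ^ 2)%N.
Proof.
rewrite /links -mulnn -[leqRHS]sum_nat_const; apply: leq_sum => x _.
by rewrite -[leqRHS]sum1_card; apply: leq_sum => y _; exact: leq_b1.
Qed.

Lemma nbrs_le U v a : (nbrs U v a <= #|U|)%N.
Proof. by rewrite -[leqRHS]sum1_card; apply: leq_sum => y _; exact: leq_b1. Qed.

Lemma links_mono U W v : U \subset W -> (links H U v <= links H W v)%N.
Proof.
move=> UW; have h (F : V -> nat) : (\sum_(x in U) F x <= \sum_(x in W) F x)%N.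
  rewrite big_mkcond [leqRHS]big_mkcond; apply: leq_sum => x _.
  by case: ifP => // /(subsetP UW) ->.
by apply: leq_trans (h _) _; apply: leq_sum => x _; exact: h.
Qed.

(** A lost pair has a coordinate in [e]; by the symmetry of [adj], each of the two coordinates
    accounts for at most the sum of [nbrs]. *)
Lemma links_setD U e v : e \subset U ->
  (links H U v <= links H (U :\: e) v + 2 * \sum_(a in e) nbrs U v a)%N.
Proof.
move=> eU; rewrite {1}/links (big_setID e) /= (setIidPr eU).
rewrite mul2n -addnn addnA addnC; apply: leq_add => //.
apply: leq_trans (_ : \sum_(x in U :\: e) (\sum_(y in U :\: e) adj H v x y
    + \sum_(y in e) adj H v x y) <= _)%N.
  by apply: leq_sum => x _; rewrite (big_setID e) /= (setIidPr eU) addnC.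
rewrite big_split leq_add2l exchange_big; apply: leq_sum => a _.
rewrite /nbrs [leqRHS](big_setID e) /= (leq_trans _ (leq_addl _ _)) //.
by apply: leq_sum => x _; rewrite adjC.
Qed.

End Process.

Section Drift.
Variables (R : realType) (V : finType) (H : graph3 V) (Q S : {set V}).
Implicit Types (U W e A : {set V}) (v a : V).

(* The normalisation u (u - 3) turns the density of a link into an exact
   supermartingale: removing an edge costs on average the fraction 6 / u of the
   pairs, and (u - 3)(u - 6) = u (u - 3)(1 - 6 / u). *)
Definition dev U (k : V + bool) : R :=
  let u : R := #|U|%:R in
  match k with
  | inl v => - ((links H U v)%:R / (u * (u - 3)))
  | inr b => #|U :&: (if b then Q else S)|%:R / u
  end.

Lemma ratio_step (u D D' : R) : 20 <= u -> 0 <= D -> D <= u ^+ 2 ->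
  D' <= D -> D - 6 * u <= D' ->
  `|D' / ((u - 3) * (u - 6)) - D / (u * (u - 3))| <= 12 / u.
Proof.
move=> u20 D0 Du D'D DD'.
have -> : D' / ((u - 3) * (u - 6)) - D / (u * (u - 3)) =
    (D' * u - D * (u - 6)) / (u * ((u - 3) * (u - 6))).
  by field; rewrite !gt_eqF //; lra.
have p0 : 0 < (u - 3) * (u - 6) by nra.
have u0 : 0 < u by lra.
rewrite normrM normfV (gtr0_norm (mulr_gt0 u0 p0)) ler_pdivrMr ?(mulr_gt0 u0 p0) //.
rewrite mulrA divfK ?gt_eqF //.
by rewrite ler_norml; apply/andP; split; nra.
Qed.

Lemma card_setD_sub U e : e \subset U -> #|e| = 3%N ->
  #|U :\: e|%:R = #|U|%:R - 3 :> R.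
Proof.
move=> eU e3; rewrite cardsD (setIidPr eU) e3 natrB // -e3.
exact: subset_leq_card.
Qed.

Lemma dev_step U e k : e \subset U -> #|e| = 3%N -> 20 <= #|U|%:R :> R ->
  `|dev (U :\: e) k - dev U k| <= 12 / #|U|%:R.
Proof.
move=> eU e3 u20; rewrite /dev (card_setD_sub eU e3).
set u : R := #|U|%:R in u20 *.
case: k => [v|b].
  rewrite (_ : u - 3 - 3 = u - 6); last by ring.
  rewrite opprK addrC distrC; apply: ratio_step => //.
  - by rewrite /u -natrX ler_nat links_le.
  - by rewrite ler_nat links_mono // subsetDl.
  - rewrite lerBlDr /u -natrM -natrD ler_nat.
    apply: leq_trans (links_setD _ _ eU) _; rewrite leq_add2l.
    rewrite (_ : 6 = 2 * 3)%N // -mulnA leq_pmul2l // -e3 -sum_nat_const.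
    by apply: leq_sum => a _; exact: nbrs_le.
set A := if b then Q else S.
have sE : #|U :&: A|%:R = #|(U :\: e) :&: A|%:R + #|e :&: A|%:R :> R.
  rewrite -natrD; congr _%:R.
  rewrite -(cardsID e (U :&: A)) addnC; congr (_ + _)%N; apply: eq_card => z;
    rewrite !inE; first by case: (z \in e); rewrite ?andbF ?andbT.
  by case ze: (z \in e); rewrite ?andbF ?andbT // (subsetP eU).
have s3 : #|e :&: A|%:R <= 3 :> R by rewrite (ler_nat R _ 3) -e3 subset_leq_card ?subsetIl.
have s0 : 0 <= #|e :&: A|%:R :> R by [].
have su : #|(U :\: e) :&: A|%:R + 3 <= u.
  by rewrite -lerBrDr -(card_setD_sub eU e3) ler_nat subset_leq_card ?subsetIl.
rewrite sE; set s := #|(U :\: e) :&: A|%:R in su *.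
set s' := #|e :&: A|%:R in s3 s0 *.
have sp : 0 <= s by [].
have -> : s / (u - 3) - (s + s') / u = (3 * s - s' * (u - 3)) / (u * (u - 3)).
  by field; rewrite !gt_eqF //; lra.
rewrite normrM normfV (gtr0_norm (_ : 0 < u * (u - 3))); last by nra.
rewrite ler_pdivrMr; last by nra.
rewrite mulrA divfK ?gt_eqF //; last by lra.
by rewrite ler_norml; apply/andP; split; nra.
Qed.

Variables (U : {set V}) (x : {set V} -> R).
Hypothesis x0 : forall e, 0 <= x e.
Hypothesis xE : forall e, x e != 0 -> (e \in edges H) && (e \subset U).
Hypothesis xU : forall v, v \in U -> \sum_(e : {set V} | v \in e) x e = 1.

Lemma frac_sum (f : V -> R) :
  \sum_e x e * (\sum_(a in e) f a) = \sum_(a in U) f a.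
Proof.
rewrite (eq_bigr (fun e : {set V} => \sum_(v in U) if v \in e then f v * x e else 0)).
  rewrite exchange_big /=; apply: eq_bigr => v vU.
  by rewrite -[RHS]mulr1 -(xU vU) mulr_sumr -big_mkcond.
move=> e _; rewrite mulr_sumr big_mkcond [RHS]big_mkcond /=.
apply: eq_bigr => v _; have [ve|_] := boolP (v \in e); last by rewrite if_same.
case: ifP => vU; first by rewrite mulrC.
have [/eqP ->|/xE /andP[_ /subsetP/(_ v ve)]] := boolP (x e == 0).
  by rewrite mul0r.
by rewrite vU.
Qed.

Lemma frac_total : \sum_e x e = #|U|%:R / 3.
Proof.
have := frac_sum (fun=> 1); rewrite sumr_const => <-.
rewrite mulr_suml; apply: eq_bigr => e _; rewrite sumr_const.
have [/eqP ->|/xE /andP[/card_edge -> _]] := boolP (x e == 0); first by rewrite !mul0r.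
by field.
Qed.

Lemma dev_drift k : 20 <= #|U|%:R :> R ->
  \sum_e x e * (dev (U :\: e) k - dev U k) <= 0.
Proof.
move=> u20; set u : R := #|U|%:R in u20 *.
rewrite (eq_bigr (fun e => x e * dev (U :\: e) k - x e * dev U k)) => [|e _]; last first.
  by rewrite mulrBr.
rewrite big_split sumrN /= -mulr_suml frac_total -/u subr_le0.
have cE e : x e != 0 -> [/\ e \subset U, #|e| = 3%N & #|U :\: e|%:R = u - 3 :> R].
  by move=> /xE /andP[eH eU]; rewrite (card_edge eH) (card_setD_sub eU (card_edge eH)).
rewrite /dev; case: k => [v|b].
  pose D : R := (links H U v)%:R.
  have sumn : \sum_(a in U) (nbrs H U v a)%:R = D by rewrite /D /links natr_sum.
  (* Every vertex of [U] is covered with total weight 1, so the average loss is governed by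
     [D * (u / 3) - 2 * D = D * (u - 6) / 3], which the normalisation cancels exactly. *)
  apply: (@le_trans _ _ (\sum_e - (x e * ((D - 2 * \sum_(a in e) (nbrs H U v a)%:R)
      / ((u - 3) * (u - 6)))))).
    apply: ler_sum => e _; have [/eqP ->|/cE[eU e3 ->]] := boolP (x e == 0).
      by rewrite !mul0r oppr0.
    rewrite mulrN lerN2 ler_wpM2l // (_ : u - 3 - 3 = u - 6); last by ring.
    rewrite ler_wpM2r ?invr_ge0 ?mulr_ge0 //; [lra|lra|].
    rewrite lerBlDr /D; have := links_setD H v eU.
    by rewrite -(ler_nat R) natrD natrM natr_sum.
  rewrite sumrN -/D mulrN lerN2.
  rewrite (eq_bigr (fun e => (D * x e - 2 * (x e * \sum_(a in e) (nbrs H U v a)%:R))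
      / ((u - 3) * (u - 6)))) => [|e _]; last by field; rewrite !gt_eqF //; lra.
  rewrite -mulr_suml big_split sumrN /= -!mulr_sumr frac_sum frac_total sumn -/u.
  by rewrite le_eqVlt; apply/orP; left; apply/eqP; field; rewrite !gt_eqF //; lra.
set A := if b then Q else S.
pose s : R := #|U :&: A|%:R.
have cardE (e : {set V}) : #|e :&: A|%:R = \sum_(a in e) (a \in A)%:R :> R.
  rewrite -sum1_card natr_sum big_mkcond [RHS]big_mkcond; apply: eq_bigr => a _.
  by rewrite inE; case: (a \in e); case: (a \in A).
rewrite (eq_bigr (fun e => (s * x e - x e * \sum_(a in e) (a \in A)%:R) / (u - 3))).
  rewrite -mulr_suml big_split sumrN /= -!mulr_sumr frac_sum frac_total -cardE -/u -/s.
  by rewrite le_eqVlt; apply/orP; left; apply/eqP; field; rewrite !gt_eqF //; lra.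
move=> e _; have [/eqP ->|/cE[eU e3 ->]] := boolP (x e == 0).
  by rewrite !mul0r mulr0 subr0 mul0r.
have sE : s = #|(U :\: e) :&: A|%:R + #|e :&: A|%:R.
  rewrite -natrD; congr _%:R.
  rewrite -(cardsID e (U :&: A)) addnC; congr (_ + _)%N; apply: eq_card => z;
    rewrite !inE; first by case: (z \in e); rewrite ?andbF ?andbT.
  by case ze: (z \in e); rewrite ?andbF ?andbT // (subsetP eU).
by rewrite sE -cardE; ring.
Qed.

End Drift.

(** The deviation costs [g / 100]. Replacing [u * (u - 3)] by [u ^+ 2] is paid for by [g / 2], since
    [3 * (c + 3/2 * g) <= 19/6 < 7/2 <= g * u / 2]. *)
Lemma density_keep (R : realFieldType) (c g w u Dw Du : R) :
  0 <= c -> c <= 5/9 -> 0 < g -> g <= 1/3 -> 3 < w -> 7 <= g * u ->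
  (c + 2 * g) * w ^+ 2 <= Dw ->
  - (Du / (u * (u - 3))) - - (Dw / (w * (w - 3))) <= g / 100 ->
  (c + g) * u ^+ 2 <= Du.
Proof.
move=> c0 c1 g0 g1 w3 gu hw hd.
have u21 : 21 <= u by nra.
have dw : c + 2 * g <= Dw / (w * (w - 3)).
  rewrite ler_pdivlMr; last by nra.
  by apply: le_trans hw; rewrite ler_wpM2l; nra.
have : (c + 2 * g - g / 100) <= Du / (u * (u - 3)) by lra.
rewrite ler_pdivlMr; last by nra.
apply: le_trans.
have : (c + 3/2 * g) * (u * (u - 3)) <= (c + 2 * g - g / 100) * (u * (u - 3)).
  by rewrite ler_wpM2r; nra.
apply: le_trans.
suff : (c + g) * u <= (c + 3/2 * g) * (u - 3) by nra.
nra.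
Qed.

Lemma nat_ge (R : realType) (x : R) : exists n : nat, x <= n%:R.
Proof.
exists (Num.bound `|x|); apply: le_trans (ler_norm x) _.
by apply/ltW/archi_boundP.
Qed.

(** * The edge-removal process and its exponential potential *)

Section Step.
Variables (R : realType) (V : finType) (H : graph3 V) (W Q S : {set V}).
Variables (g d th : R).
Let w : R := #|W|%:R.
(** One removal moves a deviation by at most [12 / u <= 12 / (d * w)], so with this factor the
    exponents move by at most [th]. *)
Let lam : R := th * d * w / 12.

Definition potential (U : {set V}) : R :=
  \sum_k expR (lam * (dev R H Q S U k - dev R H Q S W k)).

(** Each summand is at most the potential, so the bound on the latter keeps every deviation below
    [g / 100]. Hence [U] inherits the density conditions of [frac_pm], and [exp_average] picks an
    edge from the fractional matching. *)
Lemma process_step (U : {set V}) :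
  0 < g -> g <= 1/3 -> 0 < d -> 3 < w -> 0 < th -> th <= 1/2 -> Q \subset S ->
  (forall v, v \in W -> (1/3 + 2 * g) * w ^+ 2 <= (links H W v)%:R) ->
  (forall v, v \in W -> v \notin Q ->
     (4/9 + 2 * g) * w ^+ 2 <= (links H W v)%:R) ->
  (forall v, v \in W -> v \notin S ->
     (5/9 + 2 * g) * w ^+ 2 <= (links H W v)%:R) ->
  #|W :&: Q|%:R <= 19/100 * w -> #|W :&: S|%:R <= (1/3 + g/6) * w ->
  U \subset W -> d * w <= #|U|%:R -> 20 <= #|U|%:R :> R ->
  7 <= g * #|U|%:R -> potential U <= expR (lam * (g / 100)) ->
  exists e, [/\ e \in edges H, e \subset U
    & potential (U :\: e) <= (1 + 2 * th ^+ 2) * potential U].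
Proof.
move=> g0 g1 d0 w3 th0 th1 QS D0 DQ DS cQ cS UW duw u20 gu7 potU.
have w0 : 0 < w by apply: lt_trans w3.
have lam0 : 0 < lam by rewrite /lam divr_gt0 // !mulr_gt0.
have devU k : dev R H Q S U k - dev R H Q S W k <= g / 100.
  rewrite -(ler_pM2l lam0) -ler_expR; apply: le_trans potU.
  by rewrite /potential (bigD1 k) //= lerDl sumr_ge0 // => j _; exact: expR_ge0.
have keep c v : 0 <= c -> c <= 5/9 -> (c + 2 * g) * w ^+ 2 <= (links H W v)%:R ->
    (c + g) * #|U|%:R ^+ 2 <= (links H U v)%:R.
  by move=> c0 c1 h; apply: (density_keep c0 c1 g0 g1 w3 gu7 h (devU (inl v))).
have keepA (b : bool) c : #|W :&: (if b then Q else S)|%:R <= c * w ->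
    #|U :&: (if b then Q else S)|%:R <= (c + g / 100) * #|U|%:R.
  move=> h; have := devU (inr b); rewrite /dev -/w => dv.
  rewrite -ler_pdivrMr; last by lra.
  have : #|W :&: (if b then Q else S)|%:R / w <= c by rewrite ler_pdivrMr.
  lra.
have uW v : v \in U -> v \in W by move/(subsetP UW).
have [|||||||||x [x0 xE xU]] := @frac_pm R V H U Q S g => //.
- by rewrite -(ltr0n R); lra.
- by move=> v vU; apply: keep; [lra|lra|exact: D0 (uW _ vU)].
- by move=> v vU vQ; apply: keep; [lra|lra|exact: DQ (uW _ vU) vQ].
- by move=> v vU vS; apply: keep; [lra|lra|exact: DS (uW _ vU) vS].
- by apply: le_trans (keepA true _ cQ) _; rewrite ler_wpM2r //; lra.
- by apply: le_trans (keepA false _ cS) _; rewrite ler_wpM2r //; lra.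
pose phi k : R := expR (lam * (dev R H Q S U k - dev R H Q S W k)).
pose dd k e : R := lam * (dev R H Q S (U :\: e) k - dev R H Q S U k).
have [||||||e xe he] := @exp_average R (V + bool)%type {set V} x phi dd th.
- exact: x0.
- by rewrite (frac_total xE xU); lra.
- by move=> k; exact: expR_ge0.
- exact: th1.
- move=> k e /xE /andP[eH eU]; rewrite /dd normrM (gtr0_norm lam0).
  apply: le_trans (_ : lam * (12 / #|U|%:R) <= _).
    by rewrite ler_pM2l // dev_step // (card_edge eH).
  rewrite mulrA ler_pdivrMr; last by lra.
  by rewrite (_ : lam * 12 = th * (d * w)) ?ler_pM2l // /lam; field.
- move=> k; rewrite /dd; under eq_bigr do rewrite mulrCA.
  by rewrite -mulr_sumr pmulr_rle0 // dev_drift.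
have /andP[eH eU] := xE e xe; exists e; split => //.
apply: le_trans he; rewrite le_eqVlt; apply/orP; left; apply/eqP.
apply: eq_bigr => k _; rewrite /phi /dd -expRD; congr expR; ring.
Qed.

(** The potential starts at the number of deviations and grows by a factor of at most
    [expR (2 * th ^+ 2)] in each of at most [w / 3] steps, so it never passes the threshold of
    [process_step]. *)
Lemma process :
  0 < g -> g <= 1/3 -> 0 < d -> 3 < w -> 0 < th -> th <= 1/2 -> Q \subset S ->
  (forall v, v \in W -> (1/3 + 2 * g) * w ^+ 2 <= (links H W v)%:R) ->
  (forall v, v \in W -> v \notin Q ->
     (4/9 + 2 * g) * w ^+ 2 <= (links H W v)%:R) ->
  (forall v, v \in W -> v \notin S ->
     (5/9 + 2 * g) * w ^+ 2 <= (links H W v)%:R) ->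
  #|W :&: Q|%:R <= 19/100 * w -> #|W :&: S|%:R <= (1/3 + g/6) * w ->
  (forall U : {set V}, d * w <= #|U|%:R ->
     20 <= #|U|%:R :> R /\ 7 <= g * #|U|%:R) ->
  (3 %| #|W|)%N ->
  #|{: V + bool}|%:R * expR (2 * th ^+ 2 * (w / 3)) <= expR (lam * (g / 100)) ->
  exists U : {set V}, [/\ U \subset W, matched H (W :\: U), (3 %| #|U|)%N
    & #|U|%:R <= d * w].
Proof.
move=> g0 g1 d0 w3 th0 th1 QS D0 DQ DS cQ cS large W3 bound.
have p0 : 0 <= 1 + 2 * th ^+ 2 by have := sqr_ge0 th => ?; lra.
have : forall j, exists U : {set V}, [/\ U \subset W, matched H (W :\: U),
    (3 %| #|U|)%N & #|U|%:R <= d * w \/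
      (#|U| + 3 * j = #|W|)%N /\
      potential U <= (1 + 2 * th ^+ 2) ^+ j * #|{: V + bool}|%:R].
  elim=> [|j [U [UW mU U3 [small|[cU pU]]]]].
  - exists W; split; rewrite ?setDv //; first exact: matched0.
    right; split; first by rewrite muln0 addn0.
    rewrite expr0 mul1r /potential (eq_bigr (fun=> 1)) => [|k _].
      by rewrite sumr_const.
    by rewrite subrr mulr0 expR0.
  - by exists U; split => //; left.
  have [small|big] := leP #|U|%:R (d * w); first by exists U; split => //; left.
  have [u20 u7] := large U (ltW big).
  have [|e [eH eU pe]] :=
    process_step g0 g1 d0 w3 th0 th1 QS D0 DQ DS cQ cS UW (ltW big) u20 u7.
    apply: le_trans bound; apply: le_trans pU _; rewrite mulrC ler_wpM2l //.
    have h1 : 1 + 2 * th ^+ 2 <= expR (2 * th ^+ 2) by exact: expR_ge1Dx.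
    apply: le_trans (_ : expR (2 * th ^+ 2) ^+ j <= _).
      by rewrite lerXn2r ?nnegrE ?expR_ge0.
    rewrite -expRM_natr ler_expR; apply: ler_wpM2l; first by rewrite mulr_ge0 ?sqr_ge0.
    rewrite ler_pdivlMr // /w -natrM ler_nat -cU mulnC; exact: leq_addl.
  have e3 := card_edge eH.
  have cUe : (#|U :\: e| + 3 = #|U|)%N.
    by rewrite cardsD (setIidPr eU) e3 subnK // -e3 subset_leq_card.
  have disj : [disjoint W :\: U & e].
    rewrite disjoint_sym disjoints_subset; apply: subset_trans eU _.
    by apply/subsetP => z zU; rewrite !inE zU.
  exists (U :\: e); split.
  - exact: subset_trans (subsetDl _ _) UW.
  - rewrite (_ : W :\: (U :\: e) = (W :\: U) :|: e).
      by apply: matchedU disj mU (matched_edge eH).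
    apply/setP => z; rewrite !inE; case ze: (z \in e) => //=; last by rewrite orbF.
    by rewrite orbT (subsetP UW) // (subsetP eU).
  - by rewrite -cUe dvdn_addl in U3.
  right; split; first by rewrite -cU -cUe mulnS addnA.
  apply: le_trans pe _; by rewrite (exprS _ j) -mulrA ler_wpM2l.
(* After this many rounds more vertices than [W] has would be removed, so the process has
   stopped. *)
move=> /(_ #|W|.+1)[U [UW mU U3 [small|[cU _]]]]; first by exists U.
by move: cU; clear; lia.
Qed.

End Step.

Lemma almost_matching (R : realType) (g d : R) :
  0 < g -> g <= 1/3 -> 0 < d -> d <= 1 ->
  exists w0 : nat, forall (V : finType) (H : graph3 V) (W Q S : {set V}),
  (w0 <= #|W|)%N -> (3 %| #|W|)%N -> (#|V| <= 2 * #|W|)%N -> Q \subset S ->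
  (forall v, v \in W -> (1/3 + 2 * g) * #|W|%:R ^+ 2 <= (links H W v)%:R) ->
  (forall v, v \in W -> v \notin Q ->
     (4/9 + 2 * g) * #|W|%:R ^+ 2 <= (links H W v)%:R) ->
  (forall v, v \in W -> v \notin S ->
     (5/9 + 2 * g) * #|W|%:R ^+ 2 <= (links H W v)%:R) ->
  #|W :&: Q|%:R <= 19/100 * #|W|%:R :> R ->
  #|W :&: S|%:R <= (1/3 + g/6) * #|W|%:R :> R ->
  exists U : {set V}, [/\ U \subset W, matched H (W :\: U), (3 %| #|U|)%N
    & #|U|%:R <= d * #|W|%:R].
Proof.
move=> g0 g1 d0 d1.
(* With this [th] the threshold exponent is [4/3 * th ^+ 2 * w]: one half absorbs the growth over
   [w / 3] steps, the other the initial number of deviations. *)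
pose th : R := d * g / 1600.
have th0 : 0 < th by rewrite divr_gt0 // mulr_gt0.
have th1 : th <= 1/2 by rewrite /th; nra.
have [n1 hn1] := nat_ge (20 / d); have [n2 hn2] := nat_ge (7 / (g * d)).
have [n3 hn3] := nat_ge (36 / th ^+ 4).
exists (n1 + n2 + n3 + 4)%N => V H W Q S wlarge W3 VW QS D0 DQ DS cQ cS.
set w : R := #|W|%:R.
have wn : n1%:R + n2%:R + n3%:R + 4 <= w by rewrite -!natrD ler_nat.
have n10 : 0 <= n1%:R :> R by []. have n20 : 0 <= n2%:R :> R by [].
have n30 : 0 <= n3%:R :> R by [].
have w1 : 20 <= d * w by rewrite mulrC -ler_pdivrMr //; lra.
have w2 : 7 <= g * d * w by rewrite mulrC -ler_pdivrMr ?mulr_gt0 //; lra.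
have w3 : 36 <= th ^+ 4 * w by rewrite mulrC -ler_pdivrMr ?exprn_gt0 //; lra.
apply: (@process R V H W Q S g d th) => //.
- by rewrite -/w; lra.
- by move=> U; rewrite -/w => h; split; nra.
rewrite -/w (_ : th * d * w / 12 * (g / 100) =
  2 * th ^+ 2 * (w / 3) + 2 / 3 * th ^+ 2 * w); last by rewrite /th; field.
rewrite expRD [leRHS]mulrC ler_wpM2r ?expR_ge0 //.
have kw : #|{: V + bool}|%:R <= 4 * w.
  rewrite card_sum card_bool natrD /w.
  have : #|V|%:R <= 2 * w by rewrite /w -natrM ler_nat.
  lra.
apply: le_trans kw _.
(* The square of a linear term suffices: its quadratic part [th ^+ 4 * w ^+ 2 / 9] is at least
   [4 * w]. *)
have : (1 + th ^+ 2 * w / 3) ^+ 2 <= expR (2 / 3 * th ^+ 2 * w).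
  rewrite (_ : 2 / 3 * th ^+ 2 * w = (th ^+ 2 * w / 3) * 2%:R); last by field.
  rewrite expRM_natr lerXn2r ?nnegrE ?expR_ge0 ?expR_ge1Dx //.
  by rewrite addr_ge0 // divr_ge0 // mulr_ge0 ?sqr_ge0.
apply: le_trans.
have -> : (1 + th ^+ 2 * w / 3) ^+ 2 = 1 + 2 * (th ^+ 2 * w / 3) + (th ^+ 4 * w) * w / 9.
  by field.
have : 36 * w <= th ^+ 4 * w * w by rewrite ler_wpM2r //; lra.
have : 0 <= th ^+ 2 * w by rewrite mulr_ge0 ?sqr_ge0 //; lra.
lra.
Qed.

(** * Choosing absorbers greedily *)

Section Greedy.
Variables (R : realFieldType) (V X T : finType) (supp : X -> {set V}).
Variables (good : pred X) (abs : X -> T -> bool) (TT : {set T}).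

Definition used (xs : seq X) : {set V} := \bigcup_(x <- xs) supp x.

Definition spread (xs : seq X) : bool :=
  pairwise (fun x y => [disjoint supp x & supp y]) xs.

Lemma disjoint_used (A : {set V}) xs :
  [disjoint A & used xs] = all (fun x => [disjoint A & supp x]) xs.
Proof.
elim: xs => [|x xs IH] /=; first by rewrite /used big_nil -setI_eq0 setI0 eqxx.
by rewrite /used big_cons -IH -!setI_eq0 setIUr setU_eq0.
Qed.

Lemma card_used (k : nat) xs : (forall x, (#|supp x| <= k)%N) ->
  (#|used xs| <= k * size xs)%N.
Proof.
move=> suppk; elim: xs => [|x xs IH]; first by rewrite /used big_nil cards0.
by rewrite /used big_cons mulnS (leq_trans (leq_card_setU _ _)) // leq_add.
Qed.

(* Weighting each target by 2^-(number of its absorbers chosen so far), some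
   unblocked candidate decreases the total weight by the factor 1 - c / 4. *)
Lemma greedy_spread (k : nat) (B c : R) (s : nat) :
  (forall x, (#|supp x| <= k)%N) -> 0 <= B ->
  (forall v, #|[set x | v \in supp x]|%:R <= B) ->
  (forall x t, abs x t -> good x) ->
  (forall t, t \in TT -> c * #|X|%:R <= #|[set x | abs x t]|%:R) ->
  0 < c -> (0 < #|TT|)%N -> (0 < #|X|)%N ->
  k%:R * s%:R * B <= c / 2 * #|X|%:R ->
  exists xs : seq X, [/\ size xs = s, spread xs, all good xs
    & \sum_(t in TT) 2^-1 ^+ count (abs^~ t) xs <= #|TT|%:R * (1 - c / 4) ^+ s].
Proof.
move=> suppk B0 degB goodP absP c0 TT0 X0.
elim: s => [_|s IHs sB].
  exists [::]; split => //; rewrite expr0 mulr1 (eq_bigr (fun=> 1)) => [|t _].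
    by rewrite sumr_const.
  by rewrite expr0.
have [|xs [xss xsp xsg xsw]] := IHs.
  by apply: le_trans sB; rewrite ler_wpM2r // ler_wpM2l // ler_nat.
pose w t : R := 2^-1 ^+ count (abs^~ t) xs.
have w0 t : 0 < w t by rewrite exprn_gt0 // invr_gt0.
pose W := \sum_(t in TT) w t.
have W0 : 0 < W.
  have [t tT] := card_gt0P TT0.
  by rewrite /W (bigD1 t) //= ltr_wpDr // sumr_ge0 // => ? _; exact: ltW.
pose free x := [disjoint supp x & used xs].
pose f x : R := (free x)%:R * \sum_(t in TT) w t * (abs x t)%:R.
have cX t : t \in TT -> c / 2 * #|X|%:R <= \sum_x (free x)%:R * (abs x t)%:R.
  move=> tT.
  (* A blocked candidate meets one of at most [k * s] used vertices, each lying in at most [B]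
     candidates; so at most half of the absorbers of a target are blocked. *)
  have blocked : \sum_x (~~ free x)%:R <= c / 2 * #|X|%:R :> R.
    apply: le_trans sB.
    apply: le_trans (_ : \sum_x \sum_(v in used xs) (v \in supp x)%:R <= _).
      apply: ler_sum => x _; have [|nf] := boolP (free x).
        by rewrite sumr_ge0.
      have /set0Pn[v] : supp x :&: used xs != set0 by rewrite setI_eq0.
      rewrite inE => /andP[vx vu]; rewrite (bigD1 v) //= vx lerDl sumr_ge0 //.
    rewrite exchange_big /=.
    apply: le_trans (_ : \sum_(v in used xs) B <= _).
      apply: ler_sum => v _; apply: le_trans (degB v).
      rewrite -sum1_card natr_sum [leRHS]big_mkcond.
      by apply: ler_sum => x _; rewrite inE; case: (v \in _).
    rewrite sumr_const -[B *+ _]mulr_natl ler_wpM2r // -natrM ler_nat.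
    apply: leq_trans (card_used xs suppk) _.
    by rewrite leq_mul2l xss leqnSn orbT.
  have := absP t tT; rewrite -sum1_card natr_sum big_mkcond /=.
  have : \sum_x (if x \in [set x | abs x t] then 1 else 0) <=
     \sum_x (free x)%:R * (abs x t)%:R + \sum_x (~~ free x)%:R :> R.
    rewrite -big_split; apply: ler_sum => x _ /=; rewrite inE.
    by case: (free x); case: (abs x t); rewrite /= ?mul1r ?mul0r ?addr0 ?add0r.
  lra.
have [x fx] : exists x, c / 2 * W <= f x.
  have [[x hx]|no] := pselect (exists x, c / 2 * W <= f x); first by exists x.
  exfalso; have : \sum_x f x < \sum_(x : X) c / 2 * W.
    apply: ltr_sum => [|x _];
      first by have [x _] := card_gt0P X0; apply/hasP; exists x; rewrite ?mem_index_enum.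
    by rewrite ltNge; apply/negP => h; apply: no; exists x.
  apply/negP; rewrite -leNgt.
  have -> : \sum_(x : X) c / 2 * W = \sum_(t in TT) w t * (c / 2 * #|X|%:R).
    have -> : \sum_(x : X) c / 2 * W = #|X|%:R * (c / 2 * W).
      by rewrite sumr_const -[LHS]mulr_natl.
    by rewrite -mulr_suml -/W; ring.
  apply: le_trans (_ : \sum_(t in TT) w t * \sum_x (free x)%:R * (abs x t)%:R <= _).
    by apply: ler_sum => t tT; rewrite ler_pM2l // cX.
  rewrite (eq_bigr (fun t => \sum_x w t * ((free x)%:R * (abs x t)%:R))) => [|t _].
    rewrite exchange_big /=; apply: ler_sum => x _; rewrite /f mulr_sumr.
    by apply: ler_sum => t _; rewrite mulrCA.
  by rewrite mulr_sumr.
have cW : 0 < c / 2 * W by rewrite mulr_gt0 // divr_gt0.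
have fx0 := lt_le_trans cW fx.
have freex : free x by move: fx0; rewrite /f; case: (free x) => //; rewrite mul0r ltxx.
have goodx : good x.
  have [/existsP[t /goodP //]|/existsPn no] := boolP [exists t, abs x t].
  move: fx0; rewrite /f big1 ?mulr0 ?ltxx // => t _.
  by rewrite (negbTE (no t)) mulr0.
exists (x :: xs); split; rewrite /= ?xss ?goodx //.
  by rewrite -/(spread xs) xsp andbT -disjoint_used.
rewrite exprS mulrCA.
(* Choosing [x] halves the weight of exactly the targets it absorbs. *)
have -> : \sum_(t in TT) 2^-1 ^+ (abs x t + count (abs^~ t) xs) =
    W - 1/2 * f x.
  have -> : f x = \sum_(t in TT) w t * (abs x t)%:R by rewrite /f freex mul1r.
  rewrite /W [X in _ - X]mulr_sumr -sumrB; apply: eq_bigr => t _.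
  by rewrite exprD -/(w t); case: (abs x t); rewrite ?expr1 ?expr0 /=; field.
have : (1 - c / 4) * W <= (1 - c / 4) * (#|TT|%:R * (1 - c / 4) ^+ s).
  have [c4|c4] := leP c 4; first by rewrite ler_wpM2l //; lra.
  have [t tT] := card_gt0P TT0.
  have h1 := absP t tT.
  have h2 : #|[set x | abs x t]|%:R <= #|X|%:R :> R by rewrite ler_nat max_card.
  have h3 : 0 < #|X|%:R :> R by rewrite ltr0n.
  exfalso; nra.
lra.
Qed.

End Greedy.

Section AbsorbAll.
Variables (V X : finType) (H : graph3 V) (supp : X -> {set V}).
Variables (good : pred X) (abs : X -> V * V * V -> bool).

Definition distinct3 (t : V * V * V) : bool :=
  [&& t.1.1 != t.1.2, t.1.1 != t.2 & t.1.2 != t.2].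

Definition set_of3 (t : V * V * V) : {set V} := [set t.1.1; t.1.2; t.2].

Hypothesis goodP : forall x, good x -> matched H (supp x).
Hypothesis absP : forall x t, abs x t -> matched H (set_of3 t :|: supp x).

Lemma matched_used xs : spread supp xs -> all good xs -> matched H (used supp xs).
Proof.
elim: xs => [|x xs IH]; first by move=> _ _; rewrite /used big_nil; exact: matched0.
rewrite /spread /= => /andP[xd xsp] /andP[gx gxs].
rewrite /used big_cons; apply: matchedU; last exact: IH.
  by rewrite -/(used _ _) disjoint_used.
exact: goodP.
Qed.

(** Three vertices of [U] are handed to one of their absorbers. Dropping it from the list lowers
    every count by at most one, which the smaller [l] allows. *)
Lemma absorb_all (l : nat) (xs : seq X) (U : {set V}) :
  spread supp xs -> all good xs -> [disjoint U & used supp xs] -> #|U| = (3 * l)%N ->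
  (forall t, distinct3 t -> (l <= count (abs^~ t) xs)%N) ->
  matched H (U :|: used supp xs).
Proof.
elim: l xs U => [|l IHl] xs U xsp xsg dU cU hc.
  move/eqP: cU; rewrite muln0 cards_eq0 => /eqP ->; rewrite set0U.
  exact: matched_used.
have /card_gt2P[x [y [z [[xU yU zU] [xy yz zx]]]]] : (2 < #|U|)%N by rewrite cU mulnS.
pose t := (x, y, z).
have dt : distinct3 t by rewrite /distinct3 xy yz eq_sym zx.
have tU : set_of3 t \subset U.
  by apply/subsetP => v; rewrite !inE => /orP[/orP[]|] /eqP ->.
have ct : #|set_of3 t| = 3%N.
  by rewrite /set_of3 -setUA cardsU1 cards2 !inE yz negb_or xy eq_sym zx.
have /hasP[x0 x0xs x0t] : has (abs^~ t) xs by rewrite has_count (leq_trans _ (hc t dt)).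
have [s1 [s2 xsE]] : exists s1 s2, xs = s1 ++ x0 :: s2.
  by case/splitPr: x0xs => s1 s2; exists s1, s2.
have usedE : used supp xs = supp x0 :|: used supp (s1 ++ s2).
  by rewrite xsE /used !big_cat big_cons /= setUCA.
have [sp1 d1] : spread supp (s1 ++ s2) /\ [disjoint supp x0 & used supp (s1 ++ s2)].
  move: xsp; rewrite xsE /spread !pairwise_cat /= allrel_consr.
  move=> /and3P[/andP[a1 a2] p1 /andP[a3 p2]].
  split; first by rewrite a2 p1 p2.
  rewrite disjoint_used all_cat a3 andbT; apply: sub_all a1 => v.
  by rewrite disjoint_sym.
have g1 : all good (s1 ++ s2).
  by move: xsg; rewrite xsE !all_cat /= => /and3P[-> _ ->].
have dU0 : [disjoint U & supp x0] /\ [disjoint U & used supp (s1 ++ s2)].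
  by move: dU; rewrite usedE -!setI_eq0 setIUr setU_eq0 => /andP.
have [dU1 dU2] := dU0.
have dtU (A : {set V}) : [disjoint U & A] ->
    [disjoint set_of3 t & A] /\ [disjoint U :\: set_of3 t & A].
  by move=> d; split; apply: disjointWl d => //; exact: subsetDl.
have -> : U :|: used supp xs = (set_of3 t :|: supp x0)
    :|: ((U :\: set_of3 t) :|: used supp (s1 ++ s2)).
  rewrite usedE; move: (set_of3 t) tU => A /subsetP AU; apply/setP => v.
  rewrite !inE; have := AU v; case: (v \in A) => [/(_ isT) ->|_] //=.
  by case: (v \in U); case: (v \in supp x0).
apply: matchedU.
- rewrite -setI_eq0 setIUl !setIUr !setU_eq0 !setI_eq0 d1.
  rewrite (dtU _ dU2).1 (disjoint_sym (supp x0)) (dtU _ dU1).2.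
  by rewrite -setI_eq0 setIDA setDIl setDv set0I eqxx.
- exact: absP.
apply: IHl => //.
- exact: (dtU _ dU2).2.
- by rewrite cardsD (setIidPr tU) ct cU mulnS addKn.
move=> t' dt'; have := hc t' dt'; rewrite xsE !count_cat /=.
case: (abs x0 t') => /= [|/ltnW //]; first by rewrite add1n addnS ltnS.
Qed.

End AbsorbAll.

(** * Absorbers on 24 vertices *)

Section Absorber.
Variables (V : finType) (H : graph3 V).

(** A matching is given by a labelling whose fibres are its edges; disjointness is automatic, and
    checking the edges becomes a finite case analysis on slots. *)
Lemma matched_fibres (K J : finType) (f : K -> V) (l : K -> J) :
  injective f -> (forall j, f @: [set k | l k == j] \in edges H) ->
  matched H (f @: [set: K]).
Proof.
move=> finj fE; exists [set f @: [set k | l k == j] | j : J]; split.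
- by apply/subsetP => _ /imsetP[j _ ->].
- apply/trivIsetP => _ _ /imsetP[i _ ->] /imsetP[j _ ->] neq.
  rewrite -setI_eq0 -imsetI; last by move=> ? ? _ _; exact: finj.
  rewrite imset_eq0; apply/eqP/setP => k; rewrite !inE; apply/negP.
  by move=> /andP[/eqP-> /eqP ij]; rewrite ij eqxx in neq.
- apply/setP => v; apply/bigcupP/imsetP.
    by move=> [_ /imsetP[j _ ->] /imsetP[k _ ->]]; exists k.
  move=> [k _ ->]; exists (f @: [set k' | l k' == l k]); first by apply: imset_f.
  by apply: imset_f; rewrite inE.
Qed.

(* The six slots (i, b) correspond to the six vertices a_i, b_i completing the
   target to three edges.  For each slot the last two bits select that vertex
   (00), its partner (01), and the two ends of a common link edge (10, 11). *)
Definition slot : finType := ('I_3 * bool * bool * bool)%type.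

Definition pick3 (t : V * V * V) (i : 'I_3) : V :=
  match val i with 0 => t.1.1 | 1 => t.1.2 | _ => t.2 end.

Implicit Types (f : {ffun slot -> V}) (t : V * V * V).

Definition body f : {set V} := f @: [set: slot].

Definition wired f : bool :=
  [&& [forall i, [forall b,
      adj H (f (i, b, false, false)) (f (i, b, true, false)) (f (i, b, true, true))
      && adj H (f (i, b, false, true)) (f (i, b, true, false)) (f (i, b, true, true))]]
   & [forall b, adj H (f (@Ordinal 3 0 isT, b, false, true))
        (f (@Ordinal 3 1 isT, b, false, true))
        (f (@Ordinal 3 2 isT, b, false, true))]].

Definition hooked f t : bool :=
  [forall i, adj H (pick3 t i) (f (i, false, false, false)) (f (i, true, false, false))].

Definition absorber f : bool := injectiveb f && wired f.

Definition absorbs f t : bool :=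
  [&& absorber f, hooked f t, distinct3 t & [forall i, pick3 t i \notin body f]].

Lemma ord3E (i : 'I_3) :
  [\/ i = @Ordinal 3 0 isT, i = @Ordinal 3 1 isT | i = @Ordinal 3 2 isT].
Proof.
by case: i => [[|[|[|//]]] hi];
  [constructor 1|constructor 2|constructor 3]; apply/val_inj.
Qed.

Lemma card_body f : (#|body f| <= 24)%N.
Proof.
apply: leq_trans (leq_imset_card _ _) _.
by rewrite cardsT !card_prod card_ord card_bool.
Qed.

Lemma imset3 (K : finType) (g : K -> V) x y z :
  g @: [set x; y; z] = [set g x; g y; g z].
Proof. by rewrite !imsetU !imset_set1. Qed.

(** Without a target, each of the six slots matches its vertex with the common link edge, and for
    each [b] the three partners form an edge: 8 edges. *)
Lemma absorber_matched f : absorber f -> matched H (body f).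
Proof.
move=> /andP[/injectiveP finj /andP[/forallP wf /forallP zf]].
pose l (k : slot) : 'I_3 * bool + bool :=
  let: (i, b, x, y) := k in if ~~ x && y then inr b else inl (i, b).
apply: (@matched_fibres _ _ f l) => // -[[i b]|b].
  rewrite (_ : [set k | _] =
      [set (i, b, false, false); (i, b, true, false); (i, b, true, true)]).
    by rewrite imset3; have /forallP/(_ b)/andP[] := wf i.
  apply/setP => -[[[i' b'] x] y]; rewrite !inE /l.
  by case: x; case: y; case: b; case: b'; case: (ord3E i) => ->; case: (ord3E i') => ->.
rewrite (_ : [set k | _] = [set (@Ordinal 3 0 isT, b, false, true);
    (@Ordinal 3 1 isT, b, false, true); (@Ordinal 3 2 isT, b, false, true)]).
  by rewrite imset3; exact: zf.
apply/setP => -[[[i' b'] x] y]; rewrite !inE /l.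
by case: x; case: y; case: b; case: b'; case: (ord3E i') => ->.
Qed.

(** With a target, each target vertex takes its two hooked vertices, and the six partners take over
    the common link edges: 9 edges. *)
Lemma absorbs_matched f t : absorbs f t -> matched H (set_of3 t :|: body f).
Proof.
move=> /and4P[/andP[/injectiveP finj /andP[/forallP wf _]] /forallP hf dt /forallP tf].
pose g (k : slot + 'I_3) : V := match k with inl k => f k | inr i => pick3 t i end.
have ginj : injective g.
  have pinj : injective (pick3 t).
    move=> i j; case/and3P: dt => h1 h2 h3.
    by case: (ord3E i) => ->; case: (ord3E j) => -> //= /eqP;
      rewrite ?(negbTE h1) ?(negbTE h2) ?(negbTE h3) // eq_sym
        ?(negbTE h1) ?(negbTE h2) ?(negbTE h3).
  move=> [k|i] [k'|j] /=; first by move/finj ->.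
  - by move=> e; have := tf j; rewrite -e imset_f.
  - by move=> e; have := tf i; rewrite e imset_f.
  - by move/pinj ->.
pose l (k : slot + 'I_3) : 'I_3 + 'I_3 * bool :=
  match k with
  | inl (i, b, x, y) => if ~~ x && ~~ y then inl i else inr (i, b)
  | inr i => inl i
  end.
have -> : set_of3 t :|: body f = g @: [set: slot + 'I_3].
  apply/setP => v; rewrite inE; apply/orP/imsetP.
    case; last by move=> /imsetP[k _ ->]; exists (inl k).
    rewrite !inE => /orP[/orP[]|] /eqP ->.
    + by exists (inr (@Ordinal 3 0 isT)).
    + by exists (inr (@Ordinal 3 1 isT)).
    + by exists (inr (@Ordinal 3 2 isT)).
  move=> [[k|i] _ ->] /=; first by right; apply: imset_f.
  by left; rewrite !inE; case: (ord3E i) => ->; rewrite /pick3 /= eqxx ?orbT.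
apply: (@matched_fibres _ _ g l) => // -[i|[i b]].
  rewrite (_ : [set k | _] =
      [set inr i; inl (i, false, false, false); inl (i, true, false, false)]).
    by rewrite imset3; exact: hf.
  apply/setP => -[[[[i' b'] x] y]|i']; rewrite !inE /l /=; last first.
    by rewrite !orbF.
  by case: x; case: y; case: b'; case: (ord3E i) => ->; case: (ord3E i') => ->.
rewrite (_ : [set k | _] =
    [set inl (i, b, false, true); inl (i, b, true, false); inl (i, b, true, true)]).
  by rewrite imset3; have /forallP/(_ b)/andP[] := wf i.
apply/setP => -[[[[i' b'] x] y]|i']; rewrite !inE /l //=.
by case: x; case: y; case: b; case: b'; case: (ord3E i) => ->; case: (ord3E i') => ->.
Qed.

End Absorber.

(** * Counting maps between finite sets *)

Lemma card_family_prod (K T : finType) (F : K -> {pred T}) :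
  #|(family F : {pred {ffun K -> T}})| = (\prod_k #|F k|)%N.
Proof. by rewrite card_family foldrE big_map enumT. Qed.

Lemma card_bigcup_le (I T : finType) (P : pred I) (F : I -> {set T}) :
  (#|\bigcup_(i | P i) F i| <= \sum_(i | P i) #|F i|)%N.
Proof.
elim/big_rec2: _ => [|i m A _ IH]; first by rewrite cards0.
by apply: leq_trans (leq_card_setU _ _) _; rewrite leq_add2l.
Qed.

Section Counting.
Variables (K V : finType).
Implicit Types f : {ffun K -> V}.

Lemma card_ffun_at (k : K) (v : V) :
  #|[set f : {ffun K -> V} | f k == v]| = (#|V| ^ #|K|.-1)%N.
Proof.
pose F (j : K) : {pred V} := if j == k then pred1 v else predT.
rewrite (_ : #|_| = #|(family F : {pred {ffun K -> V}})|).
  rewrite card_family_prod (bigD1 k) //= {1}/F eqxx card1 mul1n.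
  rewrite (eq_bigr (fun=> #|V|)) => [|j /negbTE jk]; last by rewrite /F jk.
  by rewrite prod_nat_const cardC1.
apply: eq_card => f; rewrite inE; apply/idP/familyP => [fk j|/(_ k)].
  by rewrite /F; case: eqP => [->|].
by rewrite /F eqxx.
Qed.

(** Overwriting the value at [k] by a fixed [v0] loses nothing, as it can be recovered from the
    value at [l]. *)
Lemma card_ffun_coincide (k l : K) : k != l ->
  (#|[set f : {ffun K -> V} | f k == f l]| <= #|V| ^ #|K|.-1)%N.
Proof.
move=> kl; have [v0 _|noV] := pickP (@predT V); last first.
  rewrite (_ : #|_| = 0%N) //; apply: eq_card0 => f.
  by have := noV (f k).
rewrite -(card_ffun_at k v0).
pose g f : {ffun K -> V} := [ffun j => if j == k then v0 else f j].
rewrite -(@card_in_imset _ _ g) => [|f f']; last first.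
  rewrite !inE => /eqP fk /eqP fk' /ffunP gg; apply/ffunP => j.
  have gl j' : j' != k -> f j' = f' j'.
    by move=> /negbTE jk; have := gg j'; rewrite !ffunE jk.
  have [->|jk] := eqVneq j k; last exact: gl.
  by rewrite fk fk'; apply: gl; rewrite eq_sym.
apply: subset_leq_card; apply/subsetP => _ /imsetP[f _ ->].
by rewrite inE ffunE eqxx.
Qed.

Lemma card_not_injective :
  (#|[set f : {ffun K -> V} | ~~ injectiveb f]| <= #|K| ^ 2 * #|V| ^ #|K|.-1)%N.
Proof.
rewrite -mulnn -mulnA.
apply: leq_trans (_ : \sum_(k : K) \sum_(l : K | k != l)
    #|[set f : {ffun K -> V} | f k == f l]| <= _)%N.
  rewrite pair_big_dep /=.
  apply: leq_trans (_ : #|\bigcup_(p : K * K | p.1 != p.2)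
      [set f : {ffun K -> V} | f p.1 == f p.2]| <= _)%N; last exact: card_bigcup_le.
  apply: subset_leq_card; apply/subsetP => f; rewrite inE => /injectivePn[k [l kl fkl]].
  by apply/bigcupP; exists (k, l) => //; rewrite inE fkl.
rewrite -[leqRHS]sum_nat_const; apply: leq_sum => k _.
apply: leq_trans (_ : \sum_(l : K | k != l) #|V| ^ #|K|.-1 <= _)%N.
  by apply: leq_sum => l; exact: card_ffun_coincide.
by rewrite sum_nat_const leq_mul2r max_card orbT.
Qed.

Lemma card_ffun_hits (v : V) :
  (#|[set f : {ffun K -> V} | v \in f @: [set: K]]| <= #|K| * #|V| ^ #|K|.-1)%N.
Proof.
apply: leq_trans (_ : #|\bigcup_(k : K) [set f : {ffun K -> V} | f k == v]| <= _)%N.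
  apply: subset_leq_card; apply/subsetP => f; rewrite inE => /imsetP[k _ ->].
  by apply/bigcupP; exists k; rewrite ?inE.
apply: leq_trans (card_bigcup_le _ _) _.
rewrite -[leqRHS]sum_nat_const; apply: leq_sum => k _.
by rewrite card_ffun_at.
Qed.

End Counting.

(** * Counting the absorbers of a triple *)

Section ManyAbsorbers.
Variables (R : realFieldType) (V : finType) (H : graph3 V) (Q S : {set V}).
Local Notation n := (#|V|%:R : R).

Definition hooks (v : V) : {set V * V} :=
  [set ab | [&& adj H v ab.1 ab.2, ab.1 \notin Q & ab.2 \notin Q]].
Definition big_edges : {set V * V * V} :=
  [set z | [&& adj H z.1.1 z.1.2 z.2, z.1.1 \notin S, z.1.2 \notin S & z.2 \notin S]].
Definition common (u v : V) : {set V * V} :=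
  [set p | adj H u p.1 p.2 && adj H v p.1 p.2].

(** The three stages of the choice: a hooked pair for each target vertex, two edges of partners, and
    a common link edge for each of the six slots. *)
Let C := {ffun 'I_3 -> V * V}.
Let Z := {ffun bool -> V * V * V}.
Let P := {ffun 'I_3 * bool -> V * V}.

Let cv (c : C) (j : 'I_3 * bool) : V := if j.2 then (c j.1).2 else (c j.1).1.
Let zv (z : Z) (j : 'I_3 * bool) : V := pick3 (z j.2) j.1.

Let build (q : C * Z * P) : {ffun slot -> V} := [ffun k : slot =>
  let: (i, b, x, y) := k in
  if x then (if y then (q.2 (i, b)).2 else (q.2 (i, b)).1)
  else (if y then zv q.1.2 (i, b) else cv q.1.1 (i, b))].

Let build_inj : injective build.
Proof.
move=> [[c z] p] [[c' z'] p'] /ffunP E.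
have e i b x y := E (i, b, x, y).
congr (_, _, _); apply/ffunP.
- move=> i; have := e i false false false; have := e i true false false.
  by rewrite !ffunE /cv /=; case: (c i) (c' i) => [? ?] [? ?] /= -> ->.
- move=> b; have := e (@Ordinal 3 0 isT) b false true.
  have := e (@Ordinal 3 1 isT) b false true; have := e (@Ordinal 3 2 isT) b false true.
  by rewrite !ffunE /zv /pick3 /=; case: (z b) (z' b) => [[? ?] ?] [[? ?] ?] /= -> -> ->.
- move=> [i b]; have := e i b true false; have := e i b true true.
  by rewrite !ffunE /=; case: (p _) (p' _) => [? ?] [? ?] /= -> ->.
Qed.

(** There are [3 + 2 + 6 = 11] choices, each with density at least [al], fixing [6 + 6 + 12 = 24]
    vertices. Only degenerate outcomes must be discarded, and these are of order [n ^+ 23]. *)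
Lemma many_absorbers (al : R) (t : V * V * V) : 0 < al ->
  (forall v, al * n ^+ 2 <= #|hooks v|%:R) ->
  al * n ^+ 3 <= #|big_edges|%:R ->
  (forall u v, u \notin Q -> v \notin S -> al * n ^+ 2 <= #|common u v|%:R) ->
  1296 <= al ^+ 11 * n -> distinct3 t ->
  al ^+ 11 / 2 * #|{ffun slot -> V}|%:R <= #|[set f | absorbs H f t]|%:R.
Proof.
move=> al0 hC hZ hP nlarge dt.
pose famC : {pred C} := family (fun i : 'I_3 => [in hooks (pick3 t i)]).
pose famZ : {pred Z} := family (fun _ : bool => [in big_edges]).
pose famP (cz : C * Z) : {pred P} :=
  family (fun j : 'I_3 * bool => [in common (cv cz.1 j) (zv cz.2 j)]).
pose A := [set q : C * Z * P | [&& q.1.1 \in famC, q.1.2 \in famZ & q.2 \in famP q.1]].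
have n0 : 0 <= n by [].
have notS z b i : z \in famZ -> zv z (i, b) \notin S.
  move=> /familyP/(_ b); rewrite inE => /and4P[_ h1 h2 h3].
  by rewrite /zv /=; case: (ord3E i) => ->.
have notQ c b i : c \in famC -> cv c (i, b) \notin Q.
  move=> /familyP/(_ i); rewrite inE => /and3P[_ h1 h2].
  by rewrite /cv /=; case: b.
have cardA : al ^+ 11 * n ^+ 24 <= #|A|%:R.
  have -> : #|A| = (\sum_(cz | (cz.1 \in famC) && (cz.2 \in famZ)) #|famP cz|)%N.
    rewrite (eq_bigr (fun cz => \sum_(p in famP cz) 1)%N) => [|cz _]; last first.
      by rewrite sum1_card.
    rewrite pair_big_dep /= sum1_card; apply: eq_card => q.
    by rewrite inE unfold_in /= andbA.
  rewrite natr_sum.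
  apply: le_trans (_ : \sum_(cz | (cz.1 \in famC) && (cz.2 \in famZ)) (al * n ^+ 2) ^+ 6 <= _).
    have -> : \sum_(cz | (cz.1 \in famC) && (cz.2 \in famZ)) (al * n ^+ 2) ^+ 6 =
        #|famC|%:R * #|famZ|%:R * (al * n ^+ 2) ^+ 6.
      rewrite -(pair_big (mem famC) (mem famZ) (fun _ _ => (al * n ^+ 2) ^+ 6)) /=.
      by rewrite !sumr_const -mulrnA -natrM mulr_natl mulnC.
    have cC : (al * n ^+ 2) ^+ 3 <= #|famC|%:R.
      rewrite card_family_prod natr_prod.
      have -> : (al * n ^+ 2) ^+ 3 = \prod_(i : 'I_3) (al * n ^+ 2).
        by rewrite prodr_const card_ord.
      apply: ler_prod => i _; rewrite mulr_ge0 ?(ltW al0) ?exprn_ge0 //.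
      by rewrite (eq_card (_ : _ =i hooks (pick3 t i))) // hC.
    have cZ : (al * n ^+ 3) ^+ 2 <= #|famZ|%:R.
      rewrite card_family_prod natr_prod.
      have -> : (al * n ^+ 3) ^+ 2 = \prod_(b : bool) (al * n ^+ 3).
        by rewrite prodr_const card_bool.
      by apply: ler_prod => i _; rewrite mulr_ge0 ?(ltW al0) ?exprn_ge0.
    have -> : al ^+ 11 * n ^+ 24 =
        (al * n ^+ 2) ^+ 3 * (al * n ^+ 3) ^+ 2 * (al * n ^+ 2) ^+ 6.
      by ring.
    have a2 : 0 <= al * n ^+ 2 by rewrite mulr_ge0 ?(ltW al0) ?exprn_ge0.
    have a3 : 0 <= al * n ^+ 3 by rewrite mulr_ge0 ?(ltW al0) ?exprn_ge0.
    by rewrite ler_wpM2r ?exprn_ge0 // ler_pM ?exprn_ge0.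
  apply: ler_sum => -[c z] /andP[/= cF zF].
  rewrite card_family_prod natr_prod.
  have -> : (al * n ^+ 2) ^+ 6 = \prod_(j : 'I_3 * bool) (al * n ^+ 2).
    by rewrite prodr_const card_prod card_ord card_bool.
  apply: ler_prod => -[i b] _; rewrite mulr_ge0 ?(ltW al0) ?exprn_ge0 //.
  rewrite (eq_card (_ : _ =i common (cv c (i, b)) (zv z (i, b)))) //.
  by apply: hP; [exact: notQ|exact: notS].
pose N := (#|V| ^ 23)%N.
(* Here [648 = 24 ^ 2 + 3 * 24]: coincidences among the slots, and slots hitting one of the three
   target vertices. *)
have cover : (#|A| <= #|[set f | absorbs H f t]| + 648 * N)%N.
  rewrite -(card_imset _ build_inj).
  pose B1 := [set f : {ffun slot -> V} | ~~ injectiveb f].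
  pose B2 v := [set f : {ffun slot -> V} | v \in f @: [set: slot]].
  have sub : build @: A \subset [set f | absorbs H f t] :|:
      (B1 :|: (B2 t.1.1 :|: (B2 t.1.2 :|: B2 t.2))).
    apply/subsetP => _ /imsetP[[[c z] p] q ->].
    move: q; rewrite inE /= => /and3P[cF zF pF].
    set f := build _; rewrite !inE.
    have [fi|//] := boolP (injectiveb f); last by rewrite orbT.
    have [h1|h1] := boolP (t.1.1 \in _); first by rewrite !orbT.
    have [h2|h2] := boolP (t.1.2 \in _); first by rewrite !orbT.
    have [h3|h3] := boolP (t.2 \in _); first by rewrite !orbT.
    rewrite !orbF /absorbs /absorber fi dt /=; apply/and3P; split.
    - apply/andP; split; last first.
        apply/forallP => b; rewrite !ffunE /zv /pick3 /=.
        by move/familyP/(_ b): zF; rewrite inE => /and4P[].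
      apply/forallP => i; apply/forallP => b; rewrite !ffunE.
      by move/familyP/(_ (i, b)): pF; rewrite inE.
    - apply/forallP => i; rewrite !ffunE /cv /=.
      by move/familyP/(_ i): cF; rewrite inE => /and3P[].
    - by apply/forallP => i; case: (ord3E i) => ->.
  apply: leq_trans (subset_leq_card sub) _.
  apply: leq_trans (leq_card_setU _ _) _; rewrite leq_add2l.
  have cK : #|slot| = 24%N by rewrite !card_prod card_ord card_bool.
  have b1 : (#|B1| <= 576 * N)%N.
    by have := @card_not_injective slot V; rewrite cK.
  have b2 v : (#|B2 v| <= 24 * N)%N.
    by have := @card_ffun_hits slot V v; rewrite cK.
  apply: leq_trans (leq_card_setU _ _) _; rewrite (_ : 648 = 576 + 72)%N // mulnDl.
  apply: leq_add b1 _.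
  apply: leq_trans (leq_card_setU _ _) _; rewrite (_ : 72 = 24 + (24 + 24))%N // !mulnDl.
  apply: leq_add (b2 _) _.
  by apply: leq_trans (leq_card_setU _ _) _; rewrite leq_add.
have cX : #|{ffun slot -> V}|%:R = n ^+ 24 :> R.
  by rewrite card_ffun !card_prod card_ord card_bool natrX.
rewrite cX; move: cover; rewrite -(ler_nat R) natrD natrM natrX => cover.
have : 1296 * n ^+ 23 <= al ^+ 11 * n * n ^+ 23 by rewrite ler_wpM2r ?exprn_ge0.
rewrite -mulrA -exprS => h.
have := le_trans cardA cover; lra.
Qed.

End ManyAbsorbers.

(** * Assembly *)

Section Degrees.
Variables (V : finType) (H : graph3 V).
Implicit Types (v : V) (U : {set V}).

Definition link v : {set V * V} := [set p | adj H v p.1 p.2].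

Lemma card_link v : #|link v| = links H [set: V] v.
Proof.
rewrite /links pair_big_dep /= -sum1_card big_mkcond [RHS]big_mkcond /=.
by apply: eq_bigr => -[x y] _; rewrite !inE /=; case: adj.
Qed.

Lemma links_degree v : (2 * degree H v <= links H [set: V] v)%N.
Proof.
rewrite -card_link -sum1_card (partition_big (fun p : V * V => [set v; p.1; p.2])
  (fun e => (e \in edges H) && (v \in e))) /=; last first.
  by move=> [x y]; rewrite inE /adj /= => ->; rewrite !inE eqxx.
rewrite /degree mulnC -sum_nat_const (eq_bigl (fun e => (e \in edges H) && (v \in e))).
  apply: leq_sum => e /andP[eH ve].
  have : #|e :\ v| = 2%N by have := cardsD1 v e; rewrite ve (card_edge eH) => -[].
  move/eqP/cards2P => [x [y [xy eE]]].
  have eE1 : e = [set v; x; y] by rewrite -(setD1K ve) eE setUA.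
  rewrite sum1_card; apply: leq_trans (_ : #|[set (x, y); (y, x)]| <= _)%N.
    by rewrite cards2 xpair_eqE negb_and xy.
  apply: subset_leq_card; apply/subsetP => -[a b]; rewrite !inE unfold_in /= !inE /=.
  move=> /orP[] /eqP [-> ->]; rewrite /adj -?eE1 ?eH ?eqxx //.
  by rewrite setUAC -eE1 eH eqxx.
by move=> e; rewrite inE.
Qed.

Lemma links_remove U (A : {set V}) v : A \subset U ->
  (links H U v <= links H (U :\: A) v + 2 * #|A| * #|V|)%N.
Proof.
move=> AU; apply: leq_trans (links_setD H v AU) _.
rewrite leq_add2l -mulnA leq_pmul2l // -sum_nat_const; apply: leq_sum => a _.
by apply: leq_trans (nbrs_le _ _ _ _) _; exact: max_card.
Qed.

(** Inclusion-exclusion for the link and [X * X] inside all pairs. *)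
Lemma card_setX_link (X : {set V}) v :
  (links H [set: V] v + #|X| ^ 2 <=
     #|[set p in link v | (p.1 \in X) && (p.2 \in X)]| + #|V| ^ 2)%N.
Proof.
rewrite -card_link -!mulnn -[(#|X| * _)%N]cardsX -cardsUI addnC leq_add //.
  by apply: subset_leq_card; apply/subsetP => -[x y]; rewrite !inE.
by apply: leq_trans (max_card _) _; rewrite card_prod.
Qed.

Lemma card_link_common u v :
  (links H [set: V] u + links H [set: V] v <= #|common H u v| + #|V| ^ 2)%N.
Proof.
rewrite -!card_link -mulnn -cardsUI addnC leq_add //.
  by apply: subset_leq_card; apply/subsetP => -[x y]; rewrite !inE.
by apply: leq_trans (max_card _) _; rewrite card_prod.
Qed.

Lemma card_big_edges_ge (S : {set V}) (m : nat) :
  (forall v, v \notin S ->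
     m <= #|[set p in link v | (p.1 \notin S) && (p.2 \notin S)]|)%N ->
  (#|~: S| * m <= #|big_edges H S|)%N.
Proof.
move=> hm; rewrite -sum_nat_const.
apply: leq_trans (_ : \sum_(v in ~: S)
    #|[set p in link v | (p.1 \notin S) && (p.2 \notin S)]| <= _)%N.
  by apply: leq_sum => v; rewrite inE; exact: hm.
rewrite (eq_bigr (fun v =>
    \sum_(p in [set p in link v | (p.1 \notin S) && (p.2 \notin S)]) 1)%N) => [|v _].
  rewrite pair_big_dep /= sum1_card.
  rewrite -(@card_imset _ _ (fun q : V * (V * V) => (q.1, q.2.1, q.2.2))) => [|[? [? ?]] [? [? ?]] [-> -> ->] //].
  apply: subset_leq_card; apply/subsetP => _ /imsetP[[v [x y]] h ->].
  by move: h; rewrite unfold_in /= !inE /= => /andP[-> /andP[-> /andP[-> ->]]].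
by rewrite sum1_card.
Qed.

Lemma matched_dvd3 U : matched H U -> (3 %| #|U|)%N.
Proof.
move=> [M [ME Mt <-]]; move: Mt; rewrite /trivIset => /eqP <-.
rewrite (eq_bigr (fun=> 3%N)) => [|e eM]; last by rewrite (card_edge (subsetP ME _ eM)).
by rewrite sum_nat_const dvdn_mull.
Qed.

Lemma perfect_of_matched : matched H [set: V] -> exists M, perfect_matching H M.
Proof. by move=> [M [ME Mt Mc]]; exists M; split => //; exact/trivIsetP. Qed.

Lemma count_sorted_lt (p : pred nat) (s : seq nat) (k : nat) :
  (forall x y, (x <= y)%N -> p y -> p x) -> sorted leq s ->
  ~~ p (nth 0%N s k) -> (k < size s)%N -> (count p s <= k)%N.
Proof.
move=> pmono ss pk ks; rewrite -{1}(cat_take_drop k s) count_cat.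
rewrite (_ : count p (drop k s) = 0%N).
  by rewrite addn0 (leq_trans (count_size _ _)) // size_take ks.
apply/eqP; rewrite -leqn0 leqNgt -has_count; apply/hasPn => x.
move/(nthP 0%N) => [i]; rewrite size_drop nth_drop => ik <-.
apply: contra pk; apply: pmono.
by apply: (sorted_leq_nth leq_trans leqnn) => //; rewrite ?inE ?leq_addr // -ltn_subRL.
Qed.

Lemma card_low_degree (R : realDomainType) (x : R) (i : nat) : (i < #|V|)%N ->
  x <= (deg_nth H i.+1)%:R -> (#|[set v | ((degree H v)%:R < x)%R]| <= i)%N.
Proof.
move=> iV hx; pose p (d : nat) := (d%:R < x)%R.
have -> : #|[set v | ((degree H v)%:R < x)%R]| = count p (degree_sequence H).
  rewrite /degree_sequence (permP (permEl (perm_sort _ _))) count_map.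
  rewrite enumT cardE size_filter; apply: eq_count => v /=.
  by rewrite !inE.
apply: count_sorted_lt.
- by move=> a b ab; rewrite /p; apply: le_lt_trans; rewrite ler_nat.
- by apply: sort_sorted; exact: leq_total.
- by rewrite /p -leNgt.
- by rewrite /degree_sequence size_sort size_map -cardE.
Qed.

End Degrees.

(** With [h >= 3 / x] the power is at most [expR (- 3)], and [expR 3 >= 1 + 3]. *)
Lemma power_le_quarter (R : realType) (x : R) : 0 < x -> x <= 1 ->
  exists h : nat, (1 - x) ^+ h <= 1/4.
Proof.
move=> x0 x1; have [h hx] := nat_ge (3 / x); exists h.
have e1 : (1 - x) ^+ h <= expR (- x * h%:R).
  by rewrite expRM_natr lerXn2r ?nnegrE ?expR_ge0 ?expR_ge1Dx //; lra.
apply: le_trans e1 _; rewrite mulNr expRN mul1r lef_pV2 ?posrE ?expR_gt0 //.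
apply: le_trans (expR_ge1Dx _); rewrite ler_pdivrMr // in hx; lra.
Qed.

Lemma large_mul (R : realFieldType) (x y : R) (k N : nat) :
  0 < y -> x / y <= k%:R -> (k <= N)%N -> x <= y * N%:R.
Proof.
move=> y0 xk kN; rewrite mulrC -ler_pdivrMr //.
by apply: le_trans xk _; rewrite ler_nat.
Qed.

(** With [j] about [m / 4], [2 ^ m >= (j + 1) ^ 4 >= (nu * n / 4) ^ 4], and the hypothesis
    [256 <= nu ^+ 4 * n] makes this at least [n ^ 3]. *)
Lemma cube_le_exp2 (n m : nat) (R : realFieldType) (nu : R) : 0 < nu ->
  256 <= nu ^+ 4 * n%:R -> nu * n%:R <= m.+1%:R -> (n ^ 3 <= 2 ^ m)%N.
Proof.
move=> nu0 hn hm.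
pose j := (m %/ 4)%N.
have hj : (m.+1 <= 4 * j.+1)%N by rewrite /j; clear; lia.
have h1 : nu * n%:R / 4 <= j.+1%:R.
  rewrite ler_pdivrMr // -natrM mulnC; apply: le_trans hm _; rewrite ler_nat //.
have h2 : (j.+1 ^ 4 <= 2 ^ m)%N.
  apply: (@leq_trans ((2 ^ j) ^ 4)); first by rewrite leq_exp2r // ltn_expl.
  by rewrite -expnM leq_exp2l // /j; clear; lia.
apply: leq_trans h2; rewrite -(ler_nat R) !natrX.
apply: le_trans (_ : (nu * n%:R / 4) ^+ 4 <= _).
  have -> : (nu * n%:R / 4) ^+ 4 = (nu ^+ 4 * n%:R) * n%:R ^+ 3 / 256 by field.
  by rewrite ler_pdivlMr // mulrC ler_wpM2r ?exprn_ge0.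
by rewrite lerXn2r ?nnegrE // divr_ge0 // mulr_ge0 // ltW.
Qed.

(** * Existence of the absorbing family *)

Section Family.
Variable R : realType.

(** After [h * m] greedy choices the total weight is at most [2 ^ m * 4 ^ (- m)], as there are at
    most [2 ^ m] triples. A triple with [k] absorbers alone has weight [2 ^ (- k)], so [k >= m]. *)
Lemma absorbing_family (al sig : R) : 0 < al -> al <= 1 -> 0 < sig -> sig <= 1 ->
  exists (nu : R) (n1 : nat), [/\ 0 < nu, nu <= 1 &
  forall (V : finType) (H : graph3 V) (Q S : {set V}), (n1 <= #|V|)%N ->
  (forall v, al * #|V|%:R ^+ 2 <= #|hooks H Q v|%:R) ->
  al * #|V|%:R ^+ 3 <= #|big_edges H S|%:R ->
  (forall u v, u \notin Q -> v \notin S ->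
     al * #|V|%:R ^+ 2 <= #|common H u v|%:R) ->
  exists (xs : seq {ffun slot -> V}) (m : nat),
  [/\ spread (@body V) xs, all (absorber H) xs, (size xs)%:R <= sig * #|V|%:R,
      forall t, distinct3 t -> (m <= count (absorbs H ^~ t) xs)%N
    & (0 < m)%N /\ nu * #|V|%:R <= m.+1%:R]].
Proof.
move=> al0 al1 sig0 sig1.
pose c := al ^+ 11 / 2.
have c0 : 0 < c by rewrite divr_gt0 ?exprn_gt0.
have c1 : c <= 1.
  have : al ^+ 11 <= 1 by rewrite exprn_ile1 // ltW.
  by rewrite /c; lra.
have [h hh] : exists h : nat, (1 - c / 4) ^+ h <= 1/4.
  by apply: power_le_quarter; lra.
(* Then [h * m <= sig * c * n / 1152], where [1152 = 2 * 24 * 24] comes from the blocking condition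
   of [greedy_spread]. *)
pose nu := sig * c / 1152 / h.+1%:R.
have h0 : 0 < h.+1%:R :> R by [].
have nu0 : 0 < nu by rewrite divr_gt0 // divr_gt0 // mulr_gt0.
have nuh : nu * h.+1%:R = sig * c / 1152 by rewrite /nu divfK // gt_eqF.
have sc1 : sig * c <= 1 by nra.
have nu1 : nu <= 1.
  have : 1 <= h.+1%:R :> R by rewrite ler1n.
  have : 0 < sig * c by rewrite mulr_gt0.
  by move: nuh; nra.
have c4 : 0 <= 1 - c / 4 by lra.
have q4 : 1/4 <= 2^-1 * 2^-1 :> R by lra.
have sigc : sig * c / 1152 <= sig by nra.
have [n2 hn2] := nat_ge (256 / nu ^+ 4).
have [n3 hn3] := nat_ge (1296 / al ^+ 11).
have [n4 hn4] := nat_ge (1 / nu).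
exists nu, (n2 + n3 + n4 + 3)%N; split => // V H Q S nlarge hC hZ hP.
set n : R := #|V|%:R.
have V3 : (2 < #|V|)%N by apply: leq_trans nlarge; rewrite addnS ltnS leq_addl.
have np : 0 < n by rewrite ltr0n (leq_trans _ V3).
have b2 : 256 <= nu ^+ 4 * n.
  by apply: large_mul hn2 _; rewrite ?exprn_gt0 // (leq_trans _ nlarge) // -!addnA leq_addr.
have b3 : 1296 <= al ^+ 11 * n.
  apply: large_mul hn3 _; rewrite ?exprn_gt0 // (leq_trans _ nlarge) //.
  by rewrite (addnC n2) -!addnA leq_addr.
have b4 : 1 <= nu * n.
  by apply: large_mul hn4 _; rewrite // (leq_trans _ nlarge) // addnAC leq_addl.
pose m := Num.truncn (nu * n).
have /andP[m1 m2] : m%:R <= nu * n < m.+1%:R.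
  by apply: truncn_itv; rewrite (le_trans _ b4).
have m0 : (0 < m)%N.
  by rewrite lt0n; apply/eqP => me; move: m2; rewrite me ltNge b4.
pose s := (h * m)%N.
have sn : s%:R <= sig * c / 1152 * n.
  rewrite -nuh mulrAC /s natrM mulrC.
  by apply: ler_pM => //; rewrite ler_nat.
pose TT := [set t : V * V * V | distinct3 t].
have TT0 : (0 < #|TT|)%N.
  have /card_gt2P[x [y [z [_ [xy yz zx]]]]] : (2 < #|{: V}|)%N by [].
  by apply/card_gt0P; exists (x, y, z); rewrite inE /distinct3 xy yz eq_sym zx.
have cX : #|{ffun slot -> V}|%:R = n ^+ 24 :> R.
  by rewrite card_ffun !card_prod card_ord card_bool natrX.
have X0 : (0 < #|{ffun slot -> V}|)%N by rewrite -(ltr0n R) cX exprn_gt0.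
have [|||||xs [xss xsp xsg xsw]] :=
  @greedy_spread R V {ffun slot -> V} (V * V * V)%type (@body V) (absorber H)
    (absorbs H) TT 24 (24 * n ^+ 23) c s (@card_body V) _ _ _ _ c0 TT0 X0.
- by rewrite mulr_ge0 // exprn_ge0 // ltW.
- move=> v; have := card_ffun_hits slot v.
  by rewrite !card_prod card_ord card_bool -(ler_nat R) natrM natrX.
- by move=> x t /and4P[].
- by move=> t; rewrite inE => dt; exact: (many_absorbers al0 hC hZ hP b3 dt).
- have -> : 24 * s%:R * (24 * n ^+ 23) = 576 * s%:R * n ^+ 23 by ring.
  have -> : c / 2 * #|{ffun slot -> V}|%:R = c / 2 * n * n ^+ 23.
    by rewrite cX (exprS n 23) mulrA.
  apply: ler_wpM2r; first by rewrite exprn_ge0 // ltW.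
  apply: le_trans (_ : 576 * (sig * c / 1152 * n) <= _); first by rewrite ler_pM2l.
  rewrite (_ : 576 * (sig * c / 1152 * n) = sig * (c / 2 * n)); last by field.
  by rewrite ler_piMl // mulr_ge0 ?(ltW np) // divr_ge0 // ltW.
exists xs, m; split => //; last by split=> //; exact: ltW.
  by rewrite xss; apply: le_trans sn _; rewrite ler_wpM2r ?(ltW np).
move=> t dt; have tTT : t \in TT by rewrite inE.
pose k := count (absorbs H ^~ t) xs; rewrite -/k.
have le1 : 2^-1 ^+ k <= #|TT|%:R * (1 - c / 4) ^+ s.
  apply: le_trans xsw; rewrite (bigD1 t) //= lerDl sumr_ge0 // => i _.
  by rewrite exprn_ge0 // invr_ge0.
have le2 : (1 - c / 4) ^+ s <= 2^-1 ^+ m * 2^-1 ^+ m.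
  rewrite /s exprM -exprMn; apply: lerXn2r; rewrite ?nnegrE ?exprn_ge0 ?mulr_ge0 ?invr_ge0 //.
  exact: le_trans hh q4.
have le3 : #|TT|%:R <= 2 ^+ m :> R.
  rewrite -natrX ler_nat; apply: leq_trans (_ : #|V| ^ 3 <= _)%N.
    by apply: leq_trans (max_card _) _; rewrite !card_prod !expnS expn0 muln1 mulnA.
  by apply: cube_le_exp2 nu0 b2 (ltW m2).
have : 2^-1 ^+ k <= 2^-1 ^+ m :> R.
  apply: le_trans le1 _; apply: le_trans (_ : 2 ^+ m * (2^-1 ^+ m * 2^-1 ^+ m) <= _).
    by apply: ler_pM => //; rewrite exprn_ge0.
  by rewrite mulrA exprVn mulfV ?mul1r // expf_neq0 // pnatr_eq0.
by rewrite !exprVn lef_pV2 ?posrE ?exprn_gt0 // -!natrX ler_nat leq_exp2l.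
Qed.

End Family.

(** * From link densities to the absorbing and matching conditions *)

Section Assembly.
Variables (R : realType) (V : finType) (H : graph3 V) (Q S : {set V}) (g : R).
Local Notation n := (#|V|%:R : R).

(** The densities [1/3 + g] of the link and [2/3] of the pairs avoiding [Q] exceed 1 together, so
    they overlap; [8 <= g * n] covers the difference between [n ^+ 2 - n] and [n ^+ 2]. *)
Lemma dense_hooks (v : V) :
  0 < g -> g <= 1 -> 8 <= g * n ->
  (1/3 + g) * (n ^+ 2 - n) <= (links H [set: V] v)%:R ->
  2/3 * n ^+ 2 <= (n - #|Q|%:R) ^+ 2 ->
  g / 3 * n ^+ 2 <= #|hooks H Q v|%:R.
Proof.
move=> g0 g1 gn hv hQ; have := card_setX_link H (~: Q) v.
rewrite (_ : [set p in _ | _] = hooks H Q v); last by apply/setP => p; rewrite !inE.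
rewrite cardsCs setCK -(ler_nat R) !natrD !natrX natrB ?max_card // => h.
have : 0 <= n by []. nra.
Qed.

(** At least [2/3 * n] vertices lie outside [S], so pairs outside [S] have density [4/9], which
    overlaps links of density [5/9 + g]. *)
Lemma dense_big_edges :
  0 < g -> g <= 1 -> 8 <= g * n ->
  (forall v, v \notin S -> (5/9 + g) * (n ^+ 2 - n) <= (links H [set: V] v)%:R) ->
  3 * #|S|%:R <= n ->
  g / 3 * n ^+ 3 <= #|big_edges H S|%:R.
Proof.
move=> g0 g1 gn hS cS.
have n0 : 0 <= n by [].
have dense v : v \notin S ->
    g / 2 * n ^+ 2 <= #|[set p in link H v | (p.1 \notin S) && (p.2 \notin S)]|%:R.
  move=> /hS hv; have := card_setX_link H (~: S) v.
  rewrite (_ : [set p in _ | _] = [set p in link H v | (p.1 \notin S) && (p.2 \notin S)]);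
    last by apply/setP => p; rewrite !inE.
  rewrite cardsCs setCK -(ler_nat R) !natrD !natrX natrB ?max_card // => h.
  have : 4/9 * n ^+ 2 <= (n - #|S|%:R) ^+ 2 by nra.
  nra.
pose F v := #|[set p in link H v | (p.1 \notin S) && (p.2 \notin S)]|.
have [v0 v0S|noV] := pickP (fun v => v \notin S); last first.
  have SV : #|S| = #|V|.
    by rewrite -cardsT; congr #|pred_of_set _|; apply/setP => v; rewrite inE;
      apply/negPn; rewrite (noV v).
  exfalso; move: cS; rewrite SV; nra.
pose v1 := [arg min_(v < v0 | v \notin S) F v].
have [v1S v1min] : v1 \notin S /\ forall v, v \notin S -> (F v1 <= F v)%N.
  by rewrite /v1; case: arg_minnP => // v vS vm.
have := card_big_edges_ge (m := F v1) v1min.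
rewrite cardsCs setCK -(ler_nat R) natrM natrB ?max_card //.
apply: le_trans.
have h1 := dense v1 v1S.
apply: le_trans (_ : (2/3 * n) * (g / 2 * n ^+ 2) <= _).
  by rewrite le_eqVlt; apply/orP; left; apply/eqP; field.
apply: ler_pM => //; first by rewrite mulr_ge0 // divr_ge0.
- by rewrite mulr_ge0 ?exprn_ge0 // divr_ge0 // ltW.
- lra.
Qed.

Lemma dense_common (u v : V) :
  0 < g -> g <= 1 -> 8 <= g * n ->
  (4/9 + g) * (n ^+ 2 - n) <= (links H [set: V] u)%:R ->
  (5/9 + g) * (n ^+ 2 - n) <= (links H [set: V] v)%:R ->
  g / 3 * n ^+ 2 <= #|common H u v|%:R.
Proof.
move=> g0 g1 gn hu hv; have := card_link_common H u v.
rewrite -(ler_nat R) !natrD natrX => h.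
have : 0 <= n by []. nra.
Qed.

Lemma links_after_removal (W A : {set V}) (c : R) (s : nat) (v : V) :
  W = [set: V] :\: A -> 0 <= c -> c <= 5/9 -> 0 < g -> g <= 1 -> 8 <= g * n ->
  (#|A| <= 24 * s)%N -> s%:R <= g / 2000 * n ->
  (c + g) * (n ^+ 2 - n) <= (links H [set: V] v)%:R ->
  (c + 2 * (g / 4)) * #|W|%:R ^+ 2 <= (links H W v)%:R.
Proof.
move=> WE c0 c1 g0 g1 gn cA sn hv.
have := links_remove H v (subsetT A); rewrite -WE -(ler_nat R) natrD !natrM => h.
have cA' : #|A|%:R <= 24 * s%:R :> R by rewrite -natrM ler_nat.
have Wn : #|W|%:R <= n by rewrite ler_nat max_card.
have n0 : 0 <= n by [].
have w0 : 0 <= #|W|%:R :> R by [].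
apply: le_trans (_ : (c + 2 * (g / 4)) * n ^+ 2 <= _).
  by rewrite ler_wpM2l; [|lra|rewrite lerXn2r].
(* Removal costs at most [2 * 24 * (g / 2000) < g / 40] in density, so half of [g] survives. *)
have : 2 * #|A|%:R * n <= g / 40 * n * n by rewrite ler_wpM2r //; lra.
nra.
Qed.

End Assembly.

Lemma bin2_real (R : realFieldType) (n : nat) :
  2 * 'C(n, 2)%:R = n%:R ^+ 2 - n%:R :> R.
Proof.
case: n => [|n]; first by rewrite bin0n /= mulr0 expr0n subr0.
have := bin_ffact n.+1 2; rewrite ffactnS ffactn1 (_ : 2`! = 2)%N //.
move=> /(congr1 (fun k => k%:R : R)); rewrite /= !natrM -natr1 => h; lra.
Qed.

Lemma matching_from_links (R : realType) (g : R) : 0 < g -> g <= 1 ->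
  exists n0 : nat, forall (V : finType) (H : graph3 V) (Q S : {set V}),
  (n0 <= #|V|)%N -> (3 %| #|V|)%N -> Q \subset S ->
  (forall v, (1/3 + g) * (#|V|%:R ^+ 2 - #|V|%:R) <= (links H [set: V] v)%:R) ->
  (forall v, v \notin Q ->
     (4/9 + g) * (#|V|%:R ^+ 2 - #|V|%:R) <= (links H [set: V] v)%:R) ->
  (forall v, v \notin S ->
     (5/9 + g) * (#|V|%:R ^+ 2 - #|V|%:R) <= (links H [set: V] v)%:R) ->
  2/3 * #|V|%:R ^+ 2 <= (#|V|%:R - #|Q|%:R) ^+ 2 :> R ->
  #|Q|%:R <= 187/1000 * #|V|%:R :> R ->
  3 * #|S|%:R <= #|V|%:R :> R ->
  exists M, perfect_matching H M.
Proof.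
move=> g0 g1.
have al0 : 0 < g / 3 by rewrite divr_gt0.
have al1 : g / 3 <= 1 by lra.
have sig0 : 0 < g / 2000 by rewrite divr_gt0.
have sig1 : g / 2000 <= 1 by lra.
have [p1 p2 p3 p4] : [/\ 0 <= 1/3 :> R, 1/3 <= 5/9 :> R, 0 <= 4/9 :> R & 4/9 <= 5/9 :> R].
  by split; lra.
have p5 : 0 <= 5/9 :> R by lra.
have G0 : 0 < g / 4 by rewrite divr_gt0.
have G1 : g / 4 <= 1/3 by lra.
(* The absorbers occupy at most the fraction [24 * g / 2000 = 12/1000 * g] of the vertices. *)
have numV x y : 0 <= x -> (1 - 12/1000 * g) * x <= y -> x <= 2 * y by nra.
have numQ x y : 0 <= x -> (1 - 12/1000 * g) * x <= y ->
  187/1000 * x <= 19/100 * y by nra.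
have numS x y : 0 <= x -> (1 - 12/1000 * g) * x <= y ->
  x / 3 <= (1/3 + g / 4 / 6) * y.
  move=> x0 xy; have h : 1/3 <= (1/3 + g / 4 / 6) * (1 - 12/1000 * g) by nra.
  apply: le_trans (_ : (1/3 + g / 4 / 6) * ((1 - 12/1000 * g) * x) <= _).
    by rewrite mulrA (_ : x / 3 = 1/3 * x) ?ler_wpM2r //; field.
  by rewrite ler_wpM2l //; lra.
have [nu [n1 [nu0 nu1 family]]] := absorbing_family al0 al1 sig0 sig1.
have [w0 almost] := almost_matching G0 G1 nu0 nu1.
have [n2 hn2] := nat_ge (8 / g).
exists (n1 + 2 * w0 + n2)%N => V H Q S nlarge V3 QS D0 DQ DS cQ2 cQ cS.
have gn : 8 <= g * #|V|%:R.
  by apply: large_mul hn2 _ => //; rewrite (leq_trans _ nlarge) // leq_addl.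
have [||||xs [m [xsp xsg xss hm [m0 mnu]]]] := family V H Q S.
- by rewrite (leq_trans _ nlarge) // -addnA leq_addr.
- by move=> v; apply: dense_hooks.
- exact: dense_big_edges.
- by move=> u v uQ vS; apply: dense_common => //; [exact: DQ|exact: DS].
pose A := used (@body V) xs; pose W := [set: V] :\: A.
have cA : (#|A| <= 24 * size xs)%N by apply: card_used => x; exact: card_body.
have mA : matched H A by apply: matched_used xsp xsg => x; exact: absorber_matched.
have cW : (#|W| + #|A| = #|V|)%N.
  by rewrite /W setTD cardsCs setCK subnK // max_card.
have W3 : (3 %| #|W|)%N by move: V3; rewrite -cW dvdn_addl // (matched_dvd3 mA).
have Vp : 0 <= #|V|%:R :> R by [].
have wn : (1 - 12/1000 * g) * #|V|%:R <= #|W|%:R :> R.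
  have cAr : #|A|%:R <= 24 * (size xs)%:R :> R by rewrite -natrM ler_nat.
  have cWr : #|W|%:R + #|A|%:R = #|V|%:R :> R by rewrite -natrD cW.
  clear -cAr cWr xss; lra.
have W2 : (#|V| <= 2 * #|W|)%N by rewrite -(ler_nat R) natrM numV.
have linkW c v : 0 <= c -> c <= 5/9 ->
    (c + g) * (#|V|%:R ^+ 2 - #|V|%:R) <= (links H [set: V] v)%:R ->
    (c + 2 * (g / 4)) * #|W|%:R ^+ 2 <= (links H W v)%:R.
  by move=> c0 c1; apply: (links_after_removal (s := size xs)) cA xss.
have [||||||U [UW mU U3 Usmall]] := almost V H W Q S _ W3 W2 QS.
- have : (2 * w0 <= 2 * #|W|)%N.
    apply: leq_trans W2; apply: leq_trans nlarge.
    by rewrite addnAC leq_addl.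
  by rewrite leq_pmul2l.
- by move=> v _; apply: linkW (D0 v).
- by move=> v _ /DQ; apply: linkW.
- by move=> v _ /DS; apply: linkW.
- apply: le_trans (numQ _ _ Vp wn); apply: le_trans cQ.
  by rewrite ler_nat subset_leq_card // subsetIr.
- apply: le_trans (numS _ _ Vp wn); rewrite ler_pdivlMr // mulrC.
  apply: le_trans cS; rewrite ler_pM2l //.
  by rewrite ler_nat subset_leq_card // subsetIr.
have dUA : [disjoint U & A].
  rewrite -setI_eq0 -subset0; apply: subset_trans (setSI A UW) _.
  by rewrite /W setTD setIC setICr.
have [l Ul] : exists l, #|U| = (3 * l)%N.
  by have /dvdnP[l ->] := U3; exists l; rewrite mulnC.
(* At most [nu * n <= m + 1] vertices remain, that is [3 * l <= m + 1]. *)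
have lm : (l <= m)%N.
  have : #|U|%:R <= m.+1%:R :> R.
    apply: le_trans mnu; apply: le_trans Usmall _; rewrite ler_pM2l //.
    by rewrite ler_nat max_card.
  by rewrite ler_nat Ul; move: m0; clear; lia.
have mUA : matched H (U :|: A).
  apply: (absorb_all (good := absorber H) (abs := absorbs H) _ _ xsp xsg dUA Ul).
  - by move=> x; exact: absorber_matched.
  - by move=> x t; exact: absorbs_matched.
  - by move=> t dt; exact: leq_trans lm (hm t dt).
apply: perfect_of_matched.
rewrite (_ : [set: V] = (W :\: U) :|: (U :|: A)).
  apply: matchedU => //; rewrite -setI_eq0; apply/eqP/setP => v; rewrite !inE.
  by case: (v \in U); case: (v \in A).
apply/setP => v; rewrite !inE; case vU: (v \in U); case vA: (v \in A) => //=.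
Qed.

Theorem theorem1p3 (R : realType) (gamma : R) (gamma_gt0 : 0 < gamma) :
  exists n0 : nat, forall n : nat, (n0 <= n)%N -> (3 %| n)%N ->
    forall q : nat, (1 <= q)%N ->
      q%:R <= (1 - Num.sqrt (2 / 3)) * n%:R :> R ->
    forall (V : finType) (H : graph3 V), #|V| = n ->
      (forall i : nat, (1 <= i <= n)%N ->
         (if (i <= q)%N then (1 / 3 + gamma) * 'C(n, 2)%:R + i%:R * q%:R
          else if i%:R <= n%:R / 3 :> R then (4 / 9 + gamma) * 'C(n, 2)%:R
          else (5 / 9 + gamma) * 'C(n, 2)%:R)
         <= (deg_nth H i)%:R) ->
      exists M : {set {set V}}, perfect_matching H M.
Proof.
(* Capping at 1 only weakens the degree conditions and keeps the later constants bounded. *)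
pose g := Num.min gamma 1.
have g0 : 0 < g by rewrite lt_min gamma_gt0 ltr01.
have g1 : g <= 1 by rewrite ge_min lexx orbT.
have gg : g <= gamma by rewrite ge_min lexx.
have [n0 main] := matching_from_links g0 g1.
exists n0.+1 => n nlarge n3 q q1 qn V H Vn hdeg; subst n.
set n : R := #|V|%:R in qn.
have n1 : 1 <= n by rewrite ler1n (leq_trans _ nlarge).
set C : R := 'C(#|V|, 2)%:R.
have C0 : 0 <= C by [].
have C2 : 2 * C = n ^+ 2 - n by exact: bin2_real.
set r : R := Num.sqrt (2 / 3) in qn.
have r0 : 0 <= r by exact: sqrtr_ge0.
have r2 : r ^+ 2 = 2 / 3 by rewrite sqr_sqrtr // divr_ge0.
(* A rational lower bound for the square root of 2/3; it gives [q <= 187/1000 * n], below the 1/5 of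
   [frac_pm] with room for the absorbers. *)
have r1 : 8164/10000 <= r by rewrite leNgt; apply/negP => h; clear -h r0 r2; nra.
have qs : q%:R <= 187/1000 * n by clear -qn r1 n1; nra.
have [k Vk] : exists k, #|V| = (3 * k)%N.
  by have /dvdnP[k ->] := n3; exists k; rewrite mulnC.
have kn : 3 * k%:R = n by rewrite /n Vk natrM.
have qk : (q <= k)%N by rewrite -(ler_nat R); clear -qs kn n1; lra.
pose low (c : R) := [set v | ((degree H v)%:R < (c + gamma) * C)%R].
have highE c v : v \notin low c ->
    (c + g) * (n ^+ 2 - n) <= (links H [set: V] v)%:R.
  rewrite inE -leNgt => h.
  have := links_degree H v; rewrite -(ler_nat R) natrM; apply: le_trans.
  by rewrite -C2; clear -h C0 gg; nra.
have kV : (k < #|V|)%N by rewrite -(ltr_nat R) -/n; clear -kn n1; lra.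
(* At index [q + 1] one of the last two cases applies, and either bound is at least
   [(4/9 + gamma) * C]. *)
have cQ : (#|low (4/9)| <= q)%N.
  apply: card_low_degree; first exact: leq_ltn_trans qk kV.
  have := hdeg q.+1; rewrite ltnn /= => /(_ (leq_ltn_trans qk kV)).
  apply: le_trans; case: ifP => _ //.
  by rewrite ler_wpM2r //; clear; lra.
(* Since [n = 3 * k] and [q <= k], index [k + 1] falls under the last case. *)
have cS : (#|low (5/9)| <= k)%N.
  apply: card_low_degree => //.
  have := hdeg k.+1; rewrite /= => /(_ kV); apply: le_trans.
  rewrite leqNgt ltnS qk /= ifF //; apply/negbTE.
  rewrite -ltNge -/n -[k.+1%:R]natr1; clear -kn; lra.
(* Index 1 falls under the first case because [1 <= q], so even the least degree reaches
   [(1/3 + gamma) * C]. *)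
have c0 : low (1/3) = set0.
  apply/eqP; rewrite -cards_eq0 -leqn0; apply: card_low_degree.
    by rewrite (leq_trans _ nlarge).
  have V1 : (1 <= #|V|)%N by rewrite (leq_trans _ nlarge).
  have := hdeg 1; rewrite /= q1 => /(_ V1); apply: le_trans; rewrite lerDl; exact: mulr_ge0.
have cQr : #|low (4/9)|%:R <= q%:R :> R by rewrite ler_nat.
apply: (main V H (low (4/9)) (low (5/9))) => //.
- exact: ltnW.
- apply/subsetP => v; rewrite !inE => /lt_le_trans; apply.
  by rewrite ler_wpM2r //; clear; lra.
- by move=> v; apply: highE; rewrite c0 inE.
- by move=> v; exact: highE.
- by move=> v; exact: highE.
- have h : r * n <= n - #|low (4/9)|%:R by clear -qn cQr; lra.
  rewrite -r2 -exprMn lerXn2r ?nnegrE ?mulr_ge0 //.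
  by apply: le_trans h; rewrite mulr_ge0.
- by apply: le_trans cQr qs.
- by rewrite -/n -kn ler_pM2l // ler_nat.
Qed.
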